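(* Let $0<\alpha_0\neq\beta$. For any integer $m\ge 1$, there exists a one-dimensional curve $s\mapsto (c_s,\varphi_s)$, with $s\in I$, such that $f_0(x)=\varphi_s(x)$ is an $m$-fold traveling wave solution, with constant speed $c_s$, to the equation $$2f_t+\alpha_0\Lambda[f_t]=\frac1\varepsilon\left\{f_x+\mathcal{H}[f]+(\alpha_0-\beta)\mathcal{H}[f_{xx}]\right\}+\mathcal{H}[(\Lambda f)^2]-[\mathcal{H},f][\Lambda f]+(\alpha_0-\beta)[\mathcal{H},f]\Lambda^3 f .$$
   Context: The unknown is $f:[0,T]\times\mathbb{T}\to\mathbb{R}$, where $\mathbb{T}=\mathbb{R}/2\pi\mathbb{Z}$ (functions are real-valued and $2\pi$-periodic in $x$). The equation models unidirectional capillary-gravity surface waves with odd viscosity. Here $\varepsilon>0$ is the steepness parameter (ratio between amplitude and wavelength of the wave), $\alpha_0$ represents the ratio between gravity and odd viscosity forces, and $\beta$ is the Bond number comparing gravity and capillary forces. The periodic Hilbert transform is $$\mathcal{H}[f](x)=\frac{1}{2\pi}\,\mathrm{p.v.}\int_{-\pi}^{\pi}\frac{f(y)}{\tan\left(\frac{x-y}{2}\right)}\,dy,$$ and the Zygmund operator is $\Lambda=\mathcal{H}\partial_x$. For an operator $\mathsf{T}$ and a function $f$, the commutator is $[\mathsf{T},f][g]=\mathsf{T}(fg)-f\,\mathsf{T}(g)$. A traveling wave with profile $\varphi$ and speed $c\in\mathbb{R}$ is a solution of the form $f(t,x)=\varphi(x-ct)$; it is $m$-fold if $\varphi(x+2\pi/m)=\varphi(x)$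 for all $x$. $I$ denotes the real interval of parameters of the curve. *)

(* Defs.v *)
From Stdlib Require Import Reals.
From Coquelicot Require Import Coquelicot.
Open Scope R_scope.

(* Functions on the circle R/2piZ are 2pi-periodic functions on R. *)
Definition periodic (f : R -> R) : Prop := forall x, f (x + 2 * PI) = f x.

(* [acos (cos z)] is the distance from [z] to 2piZ, so the cut-off removes the
   symmetric neighbourhood of radius [delta] of the singularity y = x on the
   circle, wherever x lies relative to [-pi, pi]. *)
Definition truncated_kernel (f : R -> R) (x delta y : R) : R :=
  if Rlt_dec delta (acos (cos (x - y))) then f y / tan ((x - y) / 2) else 0.

Definition is_hilbert (f : R -> R) (x l : R) : Prop :=
  filterlim
    (fun delta => / (2 * PI) * RInt (truncated_kernel f x delta) (- PI) PI)
    (at_right 0) (locally l).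

Definition hilbert (f : R -> R) (x : R) : R := iota (is_hilbert f x).

Definition zygmund (f : R -> R) : R -> R := hilbert (Derive f).

Definition commutator (T : (R -> R) -> R -> R) (f g : R -> R) (x : R) : R :=
  T (fun y => f y * g y) x - f x * T g x.

(* [hilbert] and [Derive] are total, with arbitrary values where the principal
   value or the derivative does not exist.  The following predicates say that
   the values are the genuine ones; continuity makes the truncated integrals
   proper Riemann integrals. *)
Definition hilbert_dom (f : R -> R) : Prop :=
  (forall x, continuous f x) /\ (forall x, exists l, is_hilbert f x l).

Definition zygmund_dom (f : R -> R) : Prop :=
  (forall x, ex_derive f x) /\ hilbert_dom (Derive f).

Definition commutator_dom (f g : R -> R) : Prop :=
  hilbert_dom (fun y => f y * g y) /\ hilbert_dom g.

Definition time_derive (f : R -> R -> R) (t x : R) : R :=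
  Derive (fun tau => f tau x) t.

Definition well_defined_at (f : R -> R -> R) (t : R) : Prop :=
  let u := f t in
  periodic u /\
  (forall x, ex_derive (fun tau => f tau x) t) /\
  zygmund_dom (time_derive f t) /\
  hilbert_dom u /\
  (forall x, ex_derive_n u 2 x) /\
  hilbert_dom (Derive_n u 2) /\
  zygmund_dom u /\
  zygmund_dom (zygmund u) /\
  zygmund_dom (zygmund (zygmund u)) /\
  hilbert_dom (fun y => zygmund u y ^ 2) /\
  commutator_dom u (zygmund u) /\
  commutator_dom u (zygmund (zygmund (zygmund u))).

Definition wave_equation_at
    (eps alpha0 beta : R) (f : R -> R -> R) (t x : R) : Prop :=
  let u := f t in
  2 * time_derive f t x + alpha0 * zygmund (time_derive f t) x
  = 1 / eps * (Derive u x + hilbert u x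
               + (alpha0 - beta) * hilbert (Derive_n u 2) x)
    + hilbert (fun y => zygmund u y ^ 2) x
    - commutator hilbert u (zygmund u) x
    + (alpha0 - beta) * commutator hilbert u (zygmund (zygmund (zygmund u))) x.

Definition classical_solution
    (eps alpha0 beta T : R) (f : R -> R -> R) : Prop :=
  forall t, 0 <= t <= T ->
    well_defined_at f t /\ forall x, wave_equation_at eps alpha0 beta f t x.

Definition traveling_wave (phi : R -> R) (c t x : R) : R := phi (x - c * t).

Definition m_fold (m : nat) (phi : R -> R) : Prop :=
  forall x, phi (x + 2 * PI / INR m) = phi x.

Definition C3 (phi : R -> R) : Prop :=
  (forall k x, (k <= 3)%nat -> ex_derive_n phi k x) /\
  (forall x, continuous (Derive_n phi 3) x).

(* Continuity of s |-> (c s, phi s) from ]a, b[ to R x C^3(R/2piZ). *)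
Definition continuous_curve
    (a b : R) (c : R -> R) (phi : R -> R -> R) : Prop :=
  forall s0, a < s0 < b -> forall eta, 0 < eta -> exists delta, 0 < delta /\
    forall s, a < s < b -> Rabs (s - s0) < delta ->
      Rabs (c s - c s0) < eta /\
      forall k x, (k <= 3)%nat ->
        Rabs (Derive_n (phi s) k x - Derive_n (phi s0) k x) < eta.

(* Every constant is a stationary solution travelling at any speed, and adding a
   constant to a solution or translating it gives another solution.  A curve
   made only of such copies is excluded by asking that it be a simple arc
   through the rest state phi 0 = 0 along which all other profiles are
   nonconstant; by continuity their amplitudes then fill an interval. *)
Definition curve_of_nontrivial_profiles
    (a b : R) (c : R -> R) (phi : R -> R -> R) : Prop :=
  a < 0 < b /\
  (forall s, a < s < b -> C3 (phi s)) /\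
  continuous_curve a b c phi /\
  (forall x, phi 0 x = 0) /\
  (forall s, a < s < b -> s <> 0 -> exists x y, phi s x <> phi s y) /\
  (forall s s', a < s < b -> a < s' < b ->
     (forall x, phi s x = phi s' x) -> s = s').

(* Main.v *)
Require Import Defs.
From Stdlib Require Import Reals ZArith Lra Lia Classical FunctionalExtensionality.
From Coquelicot Require Import Coquelicot.
Open Scope R_scope.

(* Bifurcation from the rest state.  For [phi = sum_j a_j cos(j N x)] the Hilbert
   transform exchanges cosines and sines, and in the commutator [[H, f] g] only
   the difference modes survive: its n-th sine coefficient is
   [sum_l a_{n+l} b_l].  The equation becomes, for every n >= 1,
   [symbol_n(c) a_n = quadratic_n(a)], with sum modes [k + l = n] (triangular) and
   difference modes.  Working with N-fold waves for a large multiple N of m removes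
   every resonance: [|symbol_n| >= kap n^2] for n >= 2 when c is the speed at which
   [symbol_1] vanishes.  Substituting [a_j = eta s^j b_j / j] with [b_1 = 1] makes the
   n-th equation homogeneous in s up to factors s^(2l), and leaves a factor eta in
   front of the nonlinearity, so that for eta small the remaining unknowns (the speed
   correction and the b_j, j >= 2) are the fixed point of a contraction of the
   sup-norm unit ball, Lipschitz in s for |s| <= 1/2.  The first Fourier coefficient
   of the profile is eta s, whence injectivity and nontriviality. *)

(** * Series of functions *)

(** The obstacle is a loss of derivatives: [[H, f] Λ^3 f] carries three derivatives, while inverting
    the linear symbol gains only two. In the difference modes these derivatives fall on the low mode
    [l] and not on the output mode [n]; after the substitution that mode comes with [s^(2l)], which
    beats every power of [l]. The sum modes have no such damping, but there the factor [1 / j] in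
    the substitution compensates one derivative and leaves the plain products [b_k b_(n-k)], that is
    [n + 1] bounded terms. The [1 / n] on the linear side costs one more factor [n], so the total
    growth is of order [n^2], which is what the lower bound on the symbol absorbs. Hence the sup
    norm without weights is enough, and the geometric decay comes from [s^j] alone. It lets all
    operators act term by term and settles the conditions of [well_defined_at]. The Hilbert
    transform is evaluated from its truncated integrals: folding about [x] turns each mode into a
    bounded integrand, with bounds that can be summed over modes. *)

Lemma ex_series_dom (a b : nat -> R) :
  (forall k, Rabs (a k) <= b k) -> ex_series b -> ex_series a.
Proof. intros H. exact (ex_series_le (K := R_AbsRing) (V := R_CompleteNormedModule) a b H). Qed.

Lemma Rabs_Series_le (a b : nat -> R) :
  (forall k, Rabs (a k) <= b k) -> ex_series b -> Rabs (Series a) <= Series b.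
Proof.
  intros H Hb.
  assert (Ha : ex_series (fun k => Rabs (a k))).
  { apply ex_series_dom with b; auto. intros k. rewrite Rabs_Rabsolu. auto. }
  eapply Rle_trans. { now apply Series_Rabs. }
  apply Series_le; auto. intros k. split; auto using Rabs_pos.
Qed.

Lemma series_tail (a b : nat -> R) (n : nat) :
  (forall k, Rabs (a k) <= b k) -> ex_series b ->
  Rabs (sum_n a n - Series a) <= Series b - sum_n b n.
Proof.
  intros H Hb.
  assert (Ha := ex_series_dom a b H Hb).
  rewrite (Series_incr_n a (S n)), (Series_incr_n b (S n)); auto with arith.
  rewrite !sum_n_Reals; simpl Init.Nat.pred.
  replace (sum_f_R0 a n - (sum_f_R0 a n + Series (fun k : nat => a (S n + k)%nat)))
    with (- Series (fun k : nat => a (S n + k)%nat)) by ring.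
  rewrite Rabs_Ropp.
  replace (sum_f_R0 b n + Series (fun k : nat => b (S n + k)%nat) - sum_f_R0 b n)
    with (Series (fun k : nat => b (S n + k)%nat)) by ring.
  apply Rabs_Series_le; auto.
  now apply ex_series_incr_n.
Qed.

Lemma series_tail_small (b : nat -> R) (e : R) :
  ex_series b -> 0 < e -> eventually (fun n => Rabs (Series b - sum_n b n) < e).
Proof.
  intros Hb He.
  assert (H := Series_correct b Hb). unfold is_series in H.
  assert (H' := proj1 (filterlim_locally _ _) H (mkposreal e He)).
  revert H'. apply filter_imp. intros n Hn.
  rewrite Rabs_minus_sym. exact Hn.
Qed.

(** Weierstrass test, phrased in the uniform space of functions so that the limit can pass under the
    integral. *)
Lemma series_unif {T : Type} (f : nat -> T -> R) (M : nat -> R) :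
  (forall i x, Rabs (f i x) <= M i) -> ex_series M ->
  filterlim (fun n x => sum_n (fun i => f i x) n) eventually
    (locally (T := fct_UniformSpace T R_UniformSpace) (fun x => Series (fun i => f i x))).
Proof.
  intros H HM.
  apply (filterlim_locally (U := fct_UniformSpace T R_UniformSpace)). intros e.
  generalize (series_tail_small M e HM (cond_pos e)). apply filter_imp.
  intros n Hn x.
  assert (H1 := series_tail (fun i => f i x) M n (fun k => H k x) HM).
  eapply Rle_lt_trans. { exact H1. }
  eapply Rle_lt_trans. { apply Rle_abs. } exact Hn.
Qed.

Lemma is_RInt_sum_n (f : nat -> R -> R) (I : nat -> R) (a b : R) (n : nat) :
  (forall i, is_RInt (f i) a b (I i)) ->
  is_RInt (fun y => sum_n (fun i => f i y) n) a b (sum_n I n).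
Proof.
  intros H. induction n.
  - rewrite sum_O. apply is_RInt_ext with (f 0%nat); auto.
    intros y _. now rewrite sum_O.
  - rewrite sum_Sn.
    apply is_RInt_ext with (fun y => plus (sum_n (fun i => f i y) n) (f (S n) y)).
    + intros y _. now rewrite sum_Sn.
    + now apply @is_RInt_plus.
Qed.

Lemma is_RInt_Series (f : nat -> R -> R) (I M : nat -> R) (a b : R) :
  (forall i x, Rabs (f i x) <= M i) -> ex_series M ->
  (forall i, is_RInt (f i) a b (I i)) ->
  ex_series I /\ is_RInt (fun y => Series (fun i => f i y)) a b (Series I).
Proof.
  intros H HM Hi.
  destruct (filterlim_RInt (V := R_CompleteNormedModule)
    (fun n y => sum_n (fun i => f i y) n) a b eventually _
    (fun y => Series (fun i => f i y)) (fun n => sum_n I n)) as [v [Hv1 Hv2]].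
  - intros n. now apply is_RInt_sum_n.
  - now apply series_unif with M.
  - split.
    + now exists v.
    + now rewrite (is_series_unique I v Hv1).
Qed.

Lemma ex_series_Rext (a b : nat -> R) :
  (forall k, a k = b k) -> ex_series a -> ex_series b.
Proof. exact (ex_series_ext (V := R_NormedModule) a b). Qed.

Lemma ex_series_Rplus (a b : nat -> R) :
  ex_series a -> ex_series b -> ex_series (fun k => a k + b k).
Proof. exact (ex_series_plus (V := R_NormedModule) a b). Qed.

Lemma ex_series_Rscal (c : R) (a : nat -> R) :
  ex_series a -> ex_series (fun k => c * a k).
Proof. exact (ex_series_scal_l (V := R_NormedModule) c a). Qed.

(** The mean value theorem is applied twice. The factor 1/2 of Taylor's formula is given up, as only
    the quadratic order matters. *)
Lemma taylor1_bound (f df ddf : R -> R) (C x y : R) :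
  (forall z, is_derive f z (df z)) -> (forall z, is_derive df z (ddf z)) ->
  (forall z, Rabs (ddf z) <= C) ->
  Rabs (f y - f x - (y - x) * df x) <= C * (y - x) ^ 2.
Proof.
  intros Hf Hdf HC.
  destruct (MVT_gen f x y df) as [c [Hc Ec]]; auto.
  { intros z _. apply continuity_pt_filterlim, (ex_derive_continuous (V := R_NormedModule)).
    now exists (df z). }
  destruct (MVT_gen df x c ddf) as [d [Hd Ed]]; auto.
  { intros z _. apply continuity_pt_filterlim, (ex_derive_continuous (V := R_NormedModule)).
    now exists (ddf z). }
  replace (f y - f x - (y - x) * df x) with (ddf d * (c - x) * (y - x))
    by (rewrite Ec, <- Ed; ring).
  rewrite !Rabs_mult, <- (pow2_abs (y - x)).
  assert (H1 : Rabs (c - x) <= Rabs (y - x)).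
  { revert Hc; unfold Rmin, Rmax; destruct (Rle_dec x y); intros Hc;
    unfold Rabs; repeat destruct Rcase_abs; lra. }
  assert (H2 := Rabs_pos (c - x)). assert (H3 := Rabs_pos (y - x)).
  assert (H4 := Rabs_pos (ddf d)). assert (H5 := HC d).
  replace (C * Rabs (y - x) ^ 2) with (C * Rabs (y - x) * Rabs (y - x)) by ring.
  apply Rmult_le_compat_r; auto.
  apply Rmult_le_compat; auto.
Qed.

(** A summable bound on the second derivatives makes the first-order Taylor remainder of the whole
    sum quadratic, which gives the derivative directly; the derived series needs to converge at [x]
    only. *)
Lemma is_derive_Series (f df ddf : nat -> R -> R) (M : nat -> R) (x : R) :
  (forall i z, is_derive (f i) z (df i z)) ->
  (forall i z, is_derive (df i) z (ddf i z)) ->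
  (forall i z, Rabs (ddf i z) <= M i) -> ex_series M ->
  (forall z, ex_series (fun i => f i z)) -> ex_series (fun i => df i x) ->
  is_derive (fun y => Series (fun i => f i y)) x (Series (fun i => df i x)).
Proof.
  intros Hf Hdf Hd HM Ef Edf.
  assert (B : forall y, Rabs (Series (fun i => f i y) - Series (fun i => f i x)
                 - (y - x) * Series (fun i => df i x)) <= Series M * (y - x) ^ 2).
  { intros y.
    assert (E1 := ex_series_Rscal (- (y - x)) _ Edf).
    assert (E2 := ex_series_Rscal (-1) _ (Ef x)).
    rewrite <- Series_scal_r.
    replace (Series (fun i => f i y) - Series (fun i => f i x)
                 - (y - x) * Series (fun i => df i x))
      with (Series (fun i => f i y + -1 * f i x + - (y - x) * df i x)).
    2:{ rewrite !Series_plus, !Series_scal_l; auto. ring. now apply ex_series_Rplus. }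
    apply Rabs_Series_le.
    - intros i.
      replace (f i y + -1 * f i x + - (y - x) * df i x)
        with (f i y - f i x - (y - x) * df i x) by ring.
      now apply taylor1_bound with (ddf i).
    - now apply ex_series_scal_r. }
  apply is_derive_Reals. intros e He.
  assert (HS : 0 <= Series M).
  { eapply Rle_trans; [apply Rabs_pos|].
    apply (Rabs_Series_le (fun i => ddf i 0)); auto. }
  (* The [+ 1] keeps the radius meaningful when [Series M] is 0. *)
  assert (Hd0 : 0 < e / (Series M + 1)) by (apply Rdiv_lt_0_compat; lra).
  exists (mkposreal _ Hd0). intros t Ht0 Ht. simpl in Ht.
  specialize (B (x + t)). replace (x + t - x) with t in B by ring.
  set (A := Series (fun i => f i (x + t))) in *. set (A0 := Series (fun i => f i x)) in *.
  set (D := Series (fun i => df i x)) in *.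
  replace ((A - A0) / t - D) with ((A - A0 - t * D) / t) by (field; auto).
  unfold Rdiv. rewrite Rabs_mult, Rabs_inv.
  assert (Hat : 0 < Rabs t) by now apply Rabs_pos_lt.
  apply Rle_lt_trans with (Series M * Rabs t).
  - apply Rmult_le_reg_r with (Rabs t); auto. rewrite Rmult_assoc, Rinv_l by lra.
    rewrite <- pow2_abs in B. lra.
  - apply Rle_lt_trans with ((Series M + 1) * Rabs t); [nra|].
    apply Rmult_lt_reg_r with (/ (Series M + 1)). { apply Rinv_0_lt_compat; lra. }
    replace ((Series M + 1) * Rabs t * / (Series M + 1)) with (Rabs t) by (field; lra).
    exact Ht.
Qed.

Lemma sum_n_Series (T : nat -> nat -> R) (n : nat) :
  (forall k, ex_series (T k)) ->
  ex_series (fun l => sum_n (fun k => T k l) n) /\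
  sum_n (fun k => Series (T k)) n = Series (fun l => sum_n (fun k => T k l) n).
Proof.
  intros H. induction n as [|n [IH1 IH2]].
  - split.
    + apply ex_series_ext with (T 0%nat); auto. intros l. now rewrite sum_O.
    + rewrite sum_O. apply Series_ext. intros l. now rewrite sum_O.
  - assert (E : forall l, sum_n (fun k => T k l) n + T (S n) l = sum_n (fun k => T k l) (S n)).
    { intros l. now rewrite sum_Sn. }
    split.
    + eapply ex_series_ext. { exact E. } now apply ex_series_Rplus.
    + rewrite sum_Sn, IH2. rewrite <- (Series_ext _ _ E). rewrite Series_plus; auto.
Qed.

(** Fubini under a product majorant: after [n] rows the remainder in column [l] is at most the tail
    of [A] times [B l], so one tail controls all columns. *)
Lemma is_series_swap (T : nat -> nat -> R) (A B : nat -> R) :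
  (forall k l, Rabs (T k l) <= A k * B l) -> ex_series A -> ex_series B ->
  is_series (fun k => Series (T k)) (Series (fun l => Series (fun k => T k l))).
Proof.
  intros H HA HB.
  assert (H1 : forall k, ex_series (T k)).
  { intros k. apply ex_series_dom with (fun l => A k * B l); auto. now apply ex_series_Rscal. }
  assert (HT : forall l n, Rabs (Series (fun k => T k l) - sum_n (fun k => T k l) n)
                 <= (Series A - sum_n A n) * B l).
  { intros l n.
    rewrite Rabs_minus_sym.
    eapply Rle_trans.
    { apply series_tail with (b := fun k => A k * B l); auto. now apply ex_series_scal_r. }
    rewrite Series_scal_r. right.
    rewrite !sum_n_Reals, Rmult_minus_distr_r. f_equal.
    rewrite Rmult_comm, scal_sum. now apply sum_eq. }
  assert (HS : ex_series (fun l => Series (fun k => T k l))).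
  { apply ex_series_dom with (fun l => Series A * B l).
    - intros l. rewrite <- Series_scal_r. apply Rabs_Series_le; auto. now apply ex_series_scal_r.
    - now apply ex_series_Rscal. }
  apply (filterlim_locally (U := R_UniformSpace)). intros e.
  assert (He : 0 < e / (Rabs (Series B) + 1)).
  { apply Rdiv_lt_0_compat. apply cond_pos. assert (X := Rabs_pos (Series B)). lra. }
  generalize (series_tail_small A _ HA He). apply filter_imp. intros n Hn.
  change (Rabs (sum_n (fun k => Series (T k)) n - Series (fun l => Series (fun k => T k l))) < e).
  destruct (sum_n_Series T n H1) as [E1 E2]. rewrite E2, Rabs_minus_sym, <- Series_minus; auto.
  apply Rle_lt_trans with ((Series A - sum_n A n) * Series B).
  - rewrite <- Series_scal_l. apply Rabs_Series_le; auto. now apply ex_series_Rscal.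
  - apply Rle_lt_trans with (Rabs (Series A - sum_n A n) * (Rabs (Series B) + 1)).
    { rewrite Rmult_plus_distr_l, <- Rabs_mult.
      assert (X := Rle_abs ((Series A - sum_n A n) * Series B)).
      assert (Y := Rabs_pos (Series A - sum_n A n)). lra. }
    apply Rmult_lt_reg_r with (/ (Rabs (Series B) + 1)).
    { apply Rinv_0_lt_compat. assert (X := Rabs_pos (Series B)). lra. }
    rewrite Rmult_assoc, Rinv_r, Rmult_1_r. exact Hn.
    assert (X := Rabs_pos (Series B)). lra.
Qed.

(** * Folded principal value *)

Lemma sin_INR_PI (n : nat) : sin (INR n * PI) = 0.
Proof. apply sin_eq_0_1. exists (Z.of_nat n). now rewrite INR_IZR_INZ. Qed.

Lemma is_RInt_eq (f : R -> R) (a b v w : R) : is_RInt f a b v -> v = w -> is_RInt f a b w.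
Proof. now intros H <-. Qed.

Lemma is_RInt_cos (n : nat) :
  is_RInt (fun z => cos (INR n * z)) 0 PI (if Nat.eqb n 0 then PI else 0).
Proof.
  destruct n as [|n].
  - simpl. apply is_RInt_ext with (fun _ => 1).
    + intros z _. simpl. now rewrite Rmult_0_l, cos_0.
    + eapply is_RInt_eq.
      * apply @is_RInt_const.
      * unfold scal; simpl; unfold mult; simpl. ring.
  - assert (Hn : INR (S n) <> 0) by (apply not_0_INR; lia).
    assert (HS := sin_INR_PI (S n)). revert Hn HS. generalize (INR (S n)).
    intros w Hw HS. eapply is_RInt_eq.
    + apply (is_RInt_derive (V := R_CompleteNormedModule) (fun z => sin (w * z) / w)).
      * intros z _. auto_derive; auto. field. auto.
      * intros z _. apply (ex_derive_continuous (V := R_NormedModule)).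
        auto_derive. auto.
    + cbv beta. rewrite HS, Rmult_0_r, sin_0.
      unfold minus, plus, opp; simpl. field. auto.
Qed.

(** Since sin((n+1)z) - sin(nz) = 2 cos((n+1/2)z) sin(z/2), the singular factor cancels and each
    step in [n] adds two cosines only. This recursion yields both the bound and the integral that
    follow. *)
Lemma sin_succ_cot (n : nat) (z : R) : sin (z / 2) <> 0 ->
  sin (INR (S n) * z) * cos (z / 2) / sin (z / 2)
  = sin (INR n * z) * cos (z / 2) / sin (z / 2) + (cos (INR n * z) + cos (INR (S n) * z)).
Proof.
  intros H. rewrite S_INR. set (u := INR n * z).
  replace ((INR n + 1) * z) with (u + 2 * (z / 2)) by (unfold u; field).
  rewrite sin_plus, cos_plus, sin_2a, cos_2a.
  field_simplify; auto. f_equal.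
  assert (E := sin2_cos2 (z / 2)). unfold Rsqr in E.
  set (s := sin (z / 2)) in *. set (c := cos (z / 2)) in *.
  replace (s ^ 3) with (s * (1 - c * c)) by (rewrite <- E; ring).
  replace (s ^ 2) with (1 - c * c) by (rewrite <- E; ring).
  ring.
Qed.

Lemma sin_cot_bound (n : nat) (z : R) :
  Rabs (sin (INR n * z) * cos (z / 2) / sin (z / 2)) <= 2 * INR n.
Proof.
  destruct (Req_dec (sin (z / 2)) 0) as [H|H].
  (* At a zero of the denominator the quotient is 0, by the convention [/ 0 = 0]. *)
  - rewrite H. unfold Rdiv. rewrite Rinv_0, Rmult_0_r, Rabs_R0.
    assert (X := pos_INR n). lra.
  - induction n.
    + simpl. rewrite Rmult_0_l, sin_0. unfold Rdiv. rewrite !Rmult_0_l, Rabs_R0. lra.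
    + rewrite sin_succ_cot, S_INR; auto.
      assert (X := COS_bound (INR n * z)). assert (Y := COS_bound (INR (S n) * z)).
      rewrite S_INR in Y.
      eapply Rle_trans. apply Rabs_triang.
      assert (Rabs (cos (INR n * z) + cos ((INR n + 1) * z)) <= 2); [|lra].
      apply Rabs_le. lra.
Qed.

Lemma sin_half_pos (z : R) : 0 < z < 2 * PI -> 0 < sin (z / 2).
Proof. intros H. apply sin_gt_0; lra. Qed.

(** Among the cosines added by the recursion only [cos (0 * z)], at the first step, has a nonzero
    integral. The value is therefore the same for all [n >= 1], so that the Hilbert transform does
    not change amplitudes. *)
Lemma is_RInt_sin_cot (n : nat) :
  is_RInt (fun z => sin (INR n * z) * cos (z / 2) / sin (z / 2)) 0 PI
    (if Nat.eqb n 0 then 0 else PI).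
Proof.
  assert (HP := PI_RGT_0).
  induction n.
  - simpl. apply is_RInt_ext with (fun _ => 0).
    + intros z _. rewrite Rmult_0_l, sin_0. unfold Rdiv. now rewrite !Rmult_0_l.
    + eapply is_RInt_eq.
      * apply @is_RInt_const.
      * unfold scal; simpl; unfold mult; simpl. ring.
  - apply is_RInt_ext with (fun z => plus (sin (INR n * z) * cos (z / 2) / sin (z / 2))
        (plus (cos (INR n * z)) (cos (INR (S n) * z)))).
    + intros z Hz. rewrite Rmin_left, Rmax_right in Hz by lra.
      symmetry. apply sin_succ_cot. apply Rgt_not_eq, sin_half_pos. lra.
    + eapply is_RInt_eq.
      * apply @is_RInt_plus; [exact IHn|]. apply @is_RInt_plus; apply is_RInt_cos.
      * destruct n; unfold plus; simpl; ring.
Qed.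

Definition pv_kernel (f : R -> R) (x z : R) : R :=
  (f (x - z) - f (x + z)) * cos (z / 2) / sin (z / 2).

(* Folding the principal value at y = x +- z leaves a bounded integrand; the
   explicit bound [M] is what makes the class closed under series. *)
Definition has_hilbert (f g : R -> R) (M : R) : Prop :=
  (forall x z, Rabs (pv_kernel f x z) <= M) /\
  (forall x, is_RInt (pv_kernel f x) 0 PI (2 * PI * g x)).

Lemma has_hilbert_ext (f f' g g' : R -> R) (M : R) :
  (forall x, f x = f' x) -> (forall x, g x = g' x) ->
  has_hilbert f g M -> has_hilbert f' g' M.
Proof.
  intros Hf Hg H.
  now rewrite <- (functional_extensionality _ _ Hf), <- (functional_extensionality _ _ Hg).
Qed.

Lemma has_hilbert_scal (c : R) (f g : R -> R) (M : R) :
  has_hilbert f g M ->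
  has_hilbert (fun x => c * f x) (fun x => c * g x) (Rabs c * M).
Proof.
  intros [H1 H2].
  assert (E : forall x z, c * pv_kernel f x z = pv_kernel (fun x => c * f x) x z).
  { intros x z. unfold pv_kernel, Rdiv. ring. }
  split.
  - intros x z. rewrite <- E, Rabs_mult. apply Rmult_le_compat_l; auto using Rabs_pos.
  - intros x. apply is_RInt_ext with (fun z => scal c (pv_kernel f x z)).
    + intros z _. apply E.
    + replace (2 * PI * (c * g x)) with (scal c (2 * PI * g x)).
      * now apply @is_RInt_scal.
      * unfold scal; simpl; unfold mult; simpl. ring.
Qed.

Lemma has_hilbert_plus (f1 f2 g1 g2 : R -> R) (M1 M2 : R) :
  has_hilbert f1 g1 M1 -> has_hilbert f2 g2 M2 ->
  has_hilbert (fun x => f1 x + f2 x) (fun x => g1 x + g2 x) (M1 + M2).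
Proof.
  intros [H1 H2] [H3 H4].
  assert (E : forall x z, pv_kernel f1 x z + pv_kernel f2 x z
                = pv_kernel (fun x => f1 x + f2 x) x z).
  { intros x z. unfold pv_kernel, Rdiv. ring. }
  split.
  - intros x z. rewrite <- E. eapply Rle_trans; [apply Rabs_triang|].
    now apply Rplus_le_compat.
  - intros x. apply is_RInt_ext with (fun z => plus (pv_kernel f1 x z) (pv_kernel f2 x z)).
    + intros z _. apply E.
    + rewrite Rmult_plus_distr_l. now apply @is_RInt_plus.
Qed.

Lemma has_hilbert_Series (f g : nat -> R -> R) (M : nat -> R) :
  (forall i, has_hilbert (f i) (g i) (M i)) -> ex_series M ->
  (forall x, ex_series (fun i => f i x)) ->
  has_hilbert (fun x => Series (fun i => f i x)) (fun x => Series (fun i => g i x)) (Series M).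
Proof.
  intros H HM Hf.
  assert (E : forall x z, Series (fun i => pv_kernel (f i) x z)
            = pv_kernel (fun x => Series (fun i => f i x)) x z).
  { intros x z. unfold pv_kernel, Rdiv. rewrite <- Series_minus by auto.
    now rewrite !Series_scal_r. }
  split.
  - intros x z. rewrite <- E. apply Rabs_Series_le; auto. intros i. apply H.
  - intros x.
    destruct (is_RInt_Series (fun i => pv_kernel (f i) x) (fun i => 2 * PI * g i x) M 0 PI)
      as [_ X]; auto.
    { intros i z. apply H. }
    { intros i. apply H. }
    rewrite <- Series_scal_l. revert X. apply is_RInt_ext. intros z _. apply E.
Qed.

(** The identity cos(A - B) - cos(A + B) = 2 sin A sin B separates [x] from [z]. The phase [h] will
    carry the displacement of the wave. *)
Lemma has_hilbert_cos (n : nat) (h : R) :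
  has_hilbert (fun y => cos (INR n * (y - h))) (fun x => sin (INR n * (x - h))) (4 * INR n).
Proof.
  assert (E : forall x z,
    2 * sin (INR n * (x - h)) * (sin (INR n * z) * cos (z / 2) / sin (z / 2))
    = pv_kernel (fun y => cos (INR n * (y - h))) x z).
  { intros x z. unfold pv_kernel.
    replace (INR n * (x - z - h)) with (INR n * (x - h) - INR n * z) by ring.
    replace (INR n * (x + z - h)) with (INR n * (x - h) + INR n * z) by ring.
    rewrite cos_plus, cos_minus. unfold Rdiv. ring. }
  split.
  - intros x z. rewrite <- E, Rabs_mult.
    assert (X := sin_cot_bound n z).
    assert (Y : Rabs (2 * sin (INR n * (x - h))) <= 2).
    { apply Rabs_le. assert (Z := SIN_bound (INR n * (x - h))). lra. }
    assert (Z := Rabs_pos (2 * sin (INR n * (x - h)))).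
    assert (W := Rabs_pos (sin (INR n * z) * cos (z / 2) / sin (z / 2))).
    replace (4 * INR n) with (2 * (2 * INR n)) by ring.
    now apply Rmult_le_compat.
  - intros x. eapply is_RInt_ext. { intros z _. apply E. }
    eapply is_RInt_eq.
    + apply @is_RInt_scal, is_RInt_sin_cot.
    + unfold scal; simpl; unfold mult; simpl.
      destruct n; simpl; rewrite ?Rmult_0_l, ?sin_0; ring.
Qed.

(** A sine is a cosine moved by a quarter period, [PI / 2 / INR n]. For [n = 0] the claim would give
    -1 as the transform of 0. *)
Lemma has_hilbert_sin (n : nat) (h : R) : n <> 0%nat ->
  has_hilbert (fun y => sin (INR n * (y - h))) (fun x => - cos (INR n * (x - h))) (4 * INR n).
Proof.
  intros Hn.
  assert (Hn' : INR n <> 0) by now apply not_0_INR.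
  generalize (has_hilbert_cos n (h + PI / 2 / INR n)).
  apply has_hilbert_ext; intros x.
  - replace (INR n * (x - (h + PI / 2 / INR n))) with (- (PI / 2 - INR n * (x - h))) by (field; auto).
    now rewrite cos_neg, cos_shift.
  - replace (INR n * (x - (h + PI / 2 / INR n))) with (- (PI / 2 - INR n * (x - h))) by (field; auto).
    now rewrite sin_neg, sin_shift.
Qed.

(** * From the folded integral to [is_hilbert] *)

Lemma periodic_INR (f : R -> R) (n : nat) (x : R) :
  periodic f -> f (x + INR n * (2 * PI)) = f x.
Proof.
  intros H. induction n.
  - simpl. f_equal. ring.
  - rewrite S_INR. rewrite <- IHn.
    replace (x + (INR n + 1) * (2 * PI)) with (x + INR n * (2 * PI) + 2 * PI) by ring.
    apply H.
Qed.

Lemma periodic_IZR (f : R -> R) (n : Z) (x : R) :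
  periodic f -> f (x + IZR n * (2 * PI)) = f x.
Proof.
  intros H. destruct (Z.le_gt_cases 0 n).
  - rewrite <- (Z2Nat.id n), <- INR_IZR_INZ; auto. now apply periodic_INR.
  - rewrite <- (periodic_INR f (Z.to_nat (- n))); auto.
    rewrite INR_IZR_INZ, Z2Nat.id by lia. rewrite opp_IZR. f_equal. ring.
Qed.

Lemma is_RInt_periodic (f : R -> R) (a b v : R) : periodic f ->
  is_RInt f a (a + 2 * PI) v -> is_RInt f b (b + 2 * PI) v.
Proof.
  intros Hp H. assert (HP := PI_RGT_0).
  assert (S : forall (n : Z) (c d w : R),
    is_RInt f (c + IZR n * (2 * PI)) (d + IZR n * (2 * PI)) w -> is_RInt f c d w).
  { intros n c d w Hw.
    apply is_RInt_ext with (fun y => scal 1 (f (1 * y + IZR n * (2 * PI)))).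
    - intros y _. unfold scal; simpl; unfold mult; simpl. rewrite !Rmult_1_l.
      now apply periodic_IZR.
    - apply @is_RInt_comp_lin. now rewrite !Rmult_1_l. }
  (* This [n] puts the translate [c] of [b] inside [[a, a + 2 PI]]; the piece from [a] to [c] is
     then moved by one period to the right end. *)
  set (n := up ((a - b) / (2 * PI))).
  destruct (archimed ((a - b) / (2 * PI))) as [A1 A2]. fold n in A1, A2.
  assert (E : (a - b) / (2 * PI) * (2 * PI) = a - b) by (field; lra).
  assert (Hn1 : a <= b + IZR n * (2 * PI)) by nra.
  assert (Hn2 : b + IZR n * (2 * PI) <= a + 2 * PI) by nra.
  apply (S n). set (c := b + IZR n * (2 * PI)) in *.
  assert (E1 : ex_RInt f a c).
  { apply (ex_RInt_Chasles_1 (V := R_CompleteNormedModule)) with (a + 2 * PI). auto. now exists v. }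
  assert (E2 : ex_RInt f c (a + 2 * PI)).
  { apply (ex_RInt_Chasles_2 (V := R_CompleteNormedModule)) with a. auto. now exists v. }
  destruct E1 as [v1 H1]. destruct E2 as [v2 H2].
  assert (Ev : v = v1 + v2).
  { rewrite <- (is_RInt_unique _ _ _ _ H). apply is_RInt_unique.
    now apply (is_RInt_Chasles (V := R_NormedModule)) with c. }
  replace (b + 2 * PI + IZR n * (2 * PI)) with (c + 2 * PI) by (unfold c; ring).
  rewrite Ev, (Rplus_comm v1 v2).
  apply (is_RInt_Chasles (V := R_NormedModule)) with (a + 2 * PI); auto.
  apply (S (-1)%Z).
  replace (a + 2 * PI + IZR (-1) * (2 * PI)) with a by (simpl; ring).
  now replace (c + 2 * PI + IZR (-1) * (2 * PI)) with c by (simpl; ring).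
Qed.

(* At the zeros of [tan] and [cos] both sides vanish because [/ 0 = 0]. *)
Lemma div_tan (u z : R) : u / tan z = u * (cos z / sin z).
Proof. unfold tan, Rdiv. rewrite Rinv_mult, Rinv_inv. ring. Qed.

Lemma acos_cos_abs (z : R) : Rabs z <= PI -> acos (cos z) = Rabs z.
Proof.
  intros H. replace (cos z) with (cos (Rabs z)).
  - apply acos_cos. split; auto. apply Rabs_pos.
  - unfold Rabs. destruct Rcase_abs; auto. apply cos_neg.
Qed.

Lemma truncated_kernel_far (f : R -> R) (x delta y : R) :
  Rabs (x - y) <= PI -> delta < Rabs (x - y) ->
  truncated_kernel f x delta y = f y * (cos ((x - y) / 2) / sin ((x - y) / 2)).
Proof.
  intros H1 H2. unfold truncated_kernel. rewrite acos_cos_abs; auto.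
  destruct Rlt_dec; [apply div_tan | easy].
Qed.

Lemma truncated_kernel_near (f : R -> R) (x delta y : R) :
  Rabs (x - y) <= PI -> Rabs (x - y) <= delta -> truncated_kernel f x delta y = 0.
Proof.
  intros H1 H2. unfold truncated_kernel. rewrite acos_cos_abs; auto.
  destruct Rlt_dec; lra.
Qed.

Lemma continuous_cot_half (z : R) :
  0 < z < 2 * PI -> continuous (fun z => cos (z / 2) / sin (z / 2)) z.
Proof.
  intros H. apply (ex_derive_continuous (V := R_NormedModule)).
  auto_derive. repeat split; auto. apply Rgt_not_eq, (sin_half_pos z). auto.
Qed.

Lemma continuous_shift (f : R -> R) (u x z : R) :
  (forall y, continuous f y) -> continuous (fun z => f (x + u * z)) z.
Proof.
  intros H. apply (continuous_comp (fun z => x + u * z) f); auto.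
  apply (ex_derive_continuous (V := R_NormedModule)). now auto_derive.
Qed.

(** Folding about [x]: the left half is reflected by y = x - z, the right half translated by y = x +
    z, and the excised middle contributes 0. *)
Lemma is_RInt_truncated_kernel (f : R -> R) (x delta : R) :
  (forall y, continuous f y) -> 0 < delta < PI ->
  exists v, is_RInt (pv_kernel f x) delta PI v /\
            is_RInt (truncated_kernel f x delta) (x - PI) (x + PI) v.
Proof.
  intros Hc Hd.
  assert (I : forall u, ex_RInt (fun z => f (x + u * z) * (cos (z / 2) / sin (z / 2))) delta PI).
  { intros u. apply (ex_RInt_continuous (V := R_CompleteNormedModule)).
    intros z Hz. rewrite Rmin_left, Rmax_right in Hz by lra.
    apply (continuous_mult (K := R_AbsRing)).
    - now apply continuous_shift.
    - apply continuous_cot_half. lra. }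
  destruct (I (-1)) as [A HA]. destruct (I 1) as [B HB]. clear I.
  exists (A - B). split.
  - apply is_RInt_ext with (fun z => minus (f (x + -1 * z) * (cos (z / 2) / sin (z / 2)))
                                       (f (x + 1 * z) * (cos (z / 2) / sin (z / 2)))).
    + intros z _. unfold pv_kernel, minus, plus, opp; simpl.
      replace (x + -1 * z) with (x - z) by ring. rewrite Rmult_1_l. unfold Rdiv. ring.
    + now apply (is_RInt_minus (V := R_NormedModule)).
  - replace (A - B) with (plus A (plus 0 (- B))) by (unfold plus; simpl; ring).
    apply (is_RInt_Chasles (V := R_NormedModule)) with (x - delta);
      [|apply (is_RInt_Chasles (V := R_NormedModule)) with (x + delta)].
    + apply is_RInt_ext with (fun y => opp (scal (-1) (f (x + -1 * (-1 * y + x)) *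
         (cos ((-1 * y + x) / 2) / sin ((-1 * y + x) / 2))))).
      * intros y Hy. rewrite Rmin_left, Rmax_right in Hy by lra.
        rewrite truncated_kernel_far by (rewrite Rabs_right; lra).
        replace (x + -1 * (-1 * y + x)) with y by ring.
        replace (-1 * y + x) with (x - y) by ring.
        unfold opp, scal; simpl; unfold mult; simpl. ring.
      * replace A with (opp (- A)) by (unfold opp; simpl; ring).
        apply (is_RInt_opp (V := R_NormedModule)).
        apply (is_RInt_comp_lin (V := R_NormedModule)
          (fun z => f (x + -1 * z) * (cos (z / 2) / sin (z / 2)))).
        replace (-1 * (x - PI) + x) with PI by ring.
        replace (-1 * (x - delta) + x) with delta by ring.
        now apply (is_RInt_swap (V := R_NormedModule)).
    + apply is_RInt_ext with (fun _ => 0).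
      * intros y Hy. rewrite Rmin_left, Rmax_right in Hy by lra.
        symmetry. apply truncated_kernel_near; apply Rabs_le; lra.
      * eapply is_RInt_eq. apply (is_RInt_const (V := R_NormedModule)).
        unfold scal; simpl; unfold mult; simpl. ring.
    + apply is_RInt_ext with (fun y => opp (scal 1 (f (x + 1 * (1 * y + - x)) *
         (cos ((1 * y + - x) / 2) / sin ((1 * y + - x) / 2))))).
      * intros y Hy. rewrite Rmin_left, Rmax_right in Hy by lra.
        rewrite truncated_kernel_far by (rewrite Rabs_left; lra).
        replace (x + 1 * (1 * y + - x)) with y by ring.
        replace ((x - y) / 2) with (- ((1 * y + - x) / 2)) by field.
        rewrite cos_neg, sin_neg. unfold Rdiv. rewrite Rinv_opp.
        unfold opp, scal; simpl; unfold mult; simpl. ring.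
      * apply (is_RInt_opp (V := R_NormedModule)).
        apply (is_RInt_comp_lin (V := R_NormedModule)
          (fun z => f (x + 1 * z) * (cos (z / 2) / sin (z / 2)))).
        replace (1 * (x + delta) + - x) with delta by ring.
        now replace (1 * (x + PI) + - x) with PI by ring.
Qed.

(** The truncation error is, up to the factor [/ (2 * PI)], the folded integral over [[0, delta]],
    hence at most [M * delta]. *)
Lemma has_hilbert_is_hilbert (f g : R -> R) (M x : R) :
  periodic f -> (forall y, continuous f y) -> has_hilbert f g M -> is_hilbert f x (g x).
Proof.
  intros Hp Hc [H1 H2]. assert (HP := PI_RGT_0).
  assert (HM : 0 <= M) by (eapply Rle_trans; [apply Rabs_pos | apply (H1 0 0)]).
  assert (Key : forall delta, 0 < delta < PI ->
    Rabs (/ (2 * PI) * RInt (truncated_kernel f x delta) (- PI) PI - g x) <= M * delta).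
  { intros d Hd.
    destruct (is_RInt_truncated_kernel f x d Hc Hd) as [v [V1 V2]].
    assert (V3 : is_RInt (truncated_kernel f x d) (- PI) PI v).
    { replace PI with (- PI + 2 * PI) at 2 by ring.
      apply is_RInt_periodic with (x - PI).
      (* A shift of [y] by a period changes the sign of both the cosine and the sine of the half
         angle, so the kernel is periodic. *)
      - intros y. unfold truncated_kernel. rewrite Hp.
        replace (x - (y + 2 * PI)) with (x - y - 2 * PI) by ring.
        rewrite <- (cos_period (x - y - 2 * PI) 1). simpl INR.
        replace (x - y - 2 * PI + 2 * 1 * PI) with (x - y) by ring.
        rewrite !div_tan.
        replace ((x - y - 2 * PI) / 2) with ((x - y) / 2 - PI) by field.
        rewrite (cos_minus ((x - y) / 2)), (sin_minus ((x - y) / 2)), cos_PI, sin_PI, !Rmult_0_r.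
        destruct Rlt_dec; auto. f_equal. unfold Rdiv.
        replace (sin ((x - y) * / 2) * -1 - 0) with (- sin ((x - y) * / 2)) by ring.
        rewrite Rinv_opp. ring.
      - now replace (x - PI + 2 * PI) with (x + PI) by ring. }
    rewrite (is_RInt_unique _ _ _ _ V3).
    destruct (ex_RInt_Chasles_1 (V := R_CompleteNormedModule) (pv_kernel f x) 0 d PI)
      as [w Hw]. { lra. } { eexists; apply H2. }
    assert (E : 2 * PI * g x = w + v).
    { rewrite <- (is_RInt_unique _ _ _ _ (H2 x)). apply is_RInt_unique.
      now apply (is_RInt_Chasles (V := R_NormedModule)) with d. }
    assert (Bw : Rabs w <= (d - 0) * M).
    { apply (norm_RInt_le_const (V := R_NormedModule) (pv_kernel f x) 0 d w M); auto. lra. }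
    replace (/ (2 * PI) * v - g x) with (- w * / (2 * PI)).
    2:{ replace v with (2 * PI * g x - w) by lra. field. lra. }
    rewrite Rabs_mult, Rabs_Ropp, Rabs_inv, (Rabs_right (2 * PI)) by lra.
    apply Rle_trans with (Rabs w * 1); [|lra].
    apply Rmult_le_compat_l; [apply Rabs_pos|].
    rewrite <- Rinv_1. apply Rinv_le_contravar. lra. assert (X := PI2_1). lra. }
  unfold is_hilbert. apply (filterlim_locally (U := R_UniformSpace)). intros e.
  assert (He := cond_pos e).
  assert (Hr : 0 < Rmin PI (e / (M + 1))).
  { apply Rmin_pos; auto. apply Rdiv_lt_0_compat; lra. }
  exists (mkposreal _ Hr). intros d Hd Hd0.
  change (Rabs (d - 0) < Rmin PI (e / (M + 1))) in Hd.
  rewrite Rminus_0_r, Rabs_right in Hd by lra.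
  assert (D1 := Rlt_le_trans _ _ _ Hd (Rmin_l _ _)).
  assert (D2 := Rlt_le_trans _ _ _ Hd (Rmin_r _ _)).
  change (Rabs (/ (2 * PI) * RInt (truncated_kernel f x d) (- PI) PI - g x) < e).
  eapply Rle_lt_trans. { apply Key. lra. }
  apply Rle_lt_trans with (d * (M + 1)); [nra|].
  apply Rmult_lt_reg_r with (/ (M + 1)). { apply Rinv_0_lt_compat; lra. }
  rewrite Rmult_assoc, Rinv_r, Rmult_1_r by lra. exact D2.
Qed.

Lemma is_hilbert_unique (f : R -> R) (x l : R) : is_hilbert f x l -> hilbert f x = l.
Proof.
  intros H. apply (iota_unique (V := R_CompleteNormedModule)); auto.
  intros y Hy.
  apply (filterlim_locally_unique (V := R_NormedModule) (F := at_right 0) _ _ _ Hy H).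
Qed.

Lemma has_hilbert_dom (f g : R -> R) (M : R) :
  periodic f -> (forall y, continuous f y) -> has_hilbert f g M -> hilbert_dom f.
Proof.
  intros Hp Hc H. split; auto. intros x. exists (g x). now apply has_hilbert_is_hilbert with M.
Qed.

Lemma has_hilbert_eq (f g : R -> R) (M : R) :
  periodic f -> (forall y, continuous f y) -> has_hilbert f g M -> hilbert f = g.
Proof.
  intros Hp Hc H. apply functional_extensionality. intros x.
  apply is_hilbert_unique. now apply has_hilbert_is_hilbert with M.
Qed.

(** * Cosine and sine series *)

(** Geometric decay is stable under [freq] and under correlation, so a single condition covers all
    the operators of the equation. *)
Definition decays (a : nat -> R) : Prop :=
  exists C r, 0 <= r < 1 /\ forall k, Rabs (a k) <= C * r ^ k.

(** The multiplier of Λ on series in the frequencies [k * N]. *)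
Definition freq (N : nat) (a : nat -> R) (k : nat) : R := INR (k * N) * a k.

Lemma decays_le (a b : nat -> R) :
  (forall k, Rabs (a k) <= Rabs (b k)) -> decays b -> decays a.
Proof.
  intros H (C & r & Hr & Hb). exists C, r. split; auto.
  intros k. eapply Rle_trans; [apply H | apply Hb].
Qed.

Lemma decays_ex (a : nat -> R) : decays a -> ex_series (fun k => Rabs (a k)).
Proof.
  intros (C & r & Hr & H). apply ex_series_dom with (fun k => C * r ^ k).
  - intros k. rewrite Rabs_Rabsolu. apply H.
  - apply ex_series_Rscal, ex_series_geom. rewrite Rabs_right; lra.
Qed.

Lemma decays_ex_series (a : nat -> R) : decays a -> ex_series a.
Proof. intros H. now apply ex_series_Rabs, decays_ex. Qed.

Lemma decays_scal (c : R) (a : nat -> R) : decays a -> decays (fun k => c * a k).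
Proof.
  intros (C & r & Hr & H). exists (Rabs c * C), r. split; auto.
  intros k. rewrite Rabs_mult, Rmult_assoc. apply Rmult_le_compat_l; auto using Rabs_pos.
Qed.

(** For [t < 1], k t^k is at most 1 + t + ... + t^(k-1) = (1 - t^k) / (1 - t). *)
Lemma INR_pow_le (t : R) (k : nat) : 0 < t < 1 -> INR k * t ^ k <= / (1 - t).
Proof.
  intros Ht.
  assert (H : INR k * t ^ k * (1 - t) <= 1 - t ^ k).
  { induction k.
    - simpl. lra.
    - rewrite S_INR. simpl pow.
      assert (P : 0 < t ^ k) by (apply pow_lt; lra).
      assert (X := pos_INR k).
      assert (t ^ k <= 1) by (rewrite <- (pow1 k); apply pow_incr; lra).
      assert (t * (INR k * t ^ k * (1 - t)) <= t * (1 - t ^ k)) by (apply Rmult_le_compat_l; lra).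
      assert (0 <= (1 - t) * (1 - t * t ^ k)) by (apply Rmult_le_pos; nra).
      lra. }
  assert (P : 0 < t ^ k) by (apply pow_lt; lra).
  apply Rmult_le_reg_r with (1 - t). lra. rewrite Rinv_l by lra. lra.
Qed.

Lemma decays_INR (a : nat -> R) : decays a -> decays (fun k => INR k * a k).
Proof.
  intros (C & r & Hr & H).
  (* The rate is relaxed from [r] to [s]. The ratio [t] lies strictly between [r / s] and 1, and is
     positive even when [r = 0], as [INR_pow_le] requires. *)
  set (s := (1 + r) / 2). set (t := (r + s) / 2 / s).
  assert (Hs : r < s < 1) by (unfold s; lra).
  assert (Ht : 0 < t < 1).
  { unfold t. split.
    - apply Rdiv_lt_0_compat; lra.
    - apply Rmult_lt_reg_r with s. lra. unfold Rdiv. rewrite Rmult_assoc, Rinv_l; lra. }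
  assert (Hts : r <= t * s).
  { unfold t. unfold Rdiv at 1. rewrite Rmult_assoc, Rinv_l; lra. }
  exists (Rabs C * / (1 - t)), s. split. lra.
  intros k. rewrite Rabs_mult, (Rabs_right (INR k)) by (apply Rle_ge, pos_INR).
  assert (P : 0 <= s ^ k) by (apply pow_le; lra).
  assert (Q : r ^ k <= t ^ k * s ^ k).
  { rewrite <- Rpow_mult_distr. apply pow_incr. lra. }
  assert (P' : 0 <= r ^ k) by (apply pow_le; lra).
  assert (I := INR_pow_le t k Ht). assert (X := pos_INR k).
  assert (Y := Rabs_pos C). assert (Z := Rle_abs C).
  apply Rle_trans with (INR k * (Rabs C * (t ^ k * s ^ k))).
  - apply Rmult_le_compat_l; auto. eapply Rle_trans; [apply H|].
    apply Rle_trans with (Rabs C * r ^ k).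
    + now apply Rmult_le_compat_r.
    + now apply Rmult_le_compat_l.
  - replace (INR k * (Rabs C * (t ^ k * s ^ k))) with (Rabs C * (INR k * t ^ k) * s ^ k) by ring.
    apply Rmult_le_compat_r; auto. now apply Rmult_le_compat_l.
Qed.

Lemma decays_freq (N : nat) (a : nat -> R) : decays a -> decays (freq N a).
Proof.
  intros H. apply decays_le with (fun k => INR N * (INR k * a k)).
  - intros k. right. unfold freq. f_equal. rewrite mult_INR. ring.
  - apply decays_scal. now apply decays_INR.
Qed.

Definition cos_series (N : nat) (h : R) (a : nat -> R) (x : R) : R :=
  Series (fun k => a k * cos (INR (k * N) * (x - h))).

Definition sin_series (N : nat) (h : R) (a : nat -> R) (x : R) : R :=
  Series (fun k => a k * sin (INR (k * N) * (x - h))).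

Lemma Rabs_mul_cos_le (u v : R) : Rabs (u * cos v) <= Rabs u.
Proof.
  rewrite Rabs_mult. rewrite <- (Rmult_1_r (Rabs u)) at 2.
  apply Rmult_le_compat_l; [apply Rabs_pos | apply Rabs_le, COS_bound].
Qed.

Lemma Rabs_mul_sin_le (u v : R) : Rabs (u * sin v) <= Rabs u.
Proof.
  rewrite Rabs_mult. rewrite <- (Rmult_1_r (Rabs u)) at 2.
  apply Rmult_le_compat_l; [apply Rabs_pos | apply Rabs_le, SIN_bound].
Qed.

Lemma ex_cos_series (N : nat) (h : R) (a : nat -> R) (x : R) :
  decays a -> ex_series (fun k => a k * cos (INR (k * N) * (x - h))).
Proof.
  intros H. apply ex_series_dom with (fun k => Rabs (a k)).
  - intros k. apply Rabs_mul_cos_le.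
  - now apply decays_ex.
Qed.

Lemma ex_sin_series (N : nat) (h : R) (a : nat -> R) (x : R) :
  decays a -> ex_series (fun k => a k * sin (INR (k * N) * (x - h))).
Proof.
  intros H. apply ex_series_dom with (fun k => Rabs (a k)).
  - intros k. apply Rabs_mul_sin_le.
  - now apply decays_ex.
Qed.

Lemma sin_series_scal (N : nat) (h c : R) (a : nat -> R) (x : R) :
  sin_series N h (fun k => c * a k) x = c * sin_series N h a x.
Proof. unfold sin_series. rewrite <- Series_scal_l. apply Series_ext. intros k. ring. Qed.

Lemma INR_period (n : nat) (x h : R) :
  INR n * (x + 2 * PI - h) = INR n * (x - h) + 2 * INR n * PI.
Proof. ring. Qed.

Lemma cos_series_periodic (N : nat) (h : R) (a : nat -> R) : periodic (cos_series N h a).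
Proof.
  intros x. apply Series_ext. intros k. now rewrite INR_period, cos_period.
Qed.

Lemma sin_series_periodic (N : nat) (h : R) (a : nat -> R) : periodic (sin_series N h a).
Proof.
  intros x. apply Series_ext. intros k. now rewrite INR_period, sin_period.
Qed.

Lemma is_derive_cos_series (N : nat) (h : R) (a : nat -> R) (x : R) : decays a ->
  is_derive (cos_series N h a) x (sin_series N h (fun k => -1 * freq N a k) x).
Proof.
  intros H. unfold cos_series, sin_series.
  apply is_derive_Series with
    (f := fun k x => a k * cos (INR (k * N) * (x - h)))
    (df := fun k x => -1 * freq N a k * sin (INR (k * N) * (x - h)))
    (ddf := fun k x => - freq N (freq N a) k * cos (INR (k * N) * (x - h)))
    (M := fun k => Rabs (freq N (freq N a) k)).
  - intros k z. unfold freq. generalize (INR (k * N)). intros w. auto_derive; auto. unfold Rminus. ring.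
  - intros k z. unfold freq. generalize (INR (k * N)). intros w. auto_derive; auto. unfold Rminus. ring.
  - intros k z. rewrite <- (Rabs_Ropp (freq N (freq N a) k)). apply Rabs_mul_cos_le.
  - now apply decays_ex, decays_freq, decays_freq.
  - intros z. now apply ex_cos_series.
  - apply (ex_sin_series N h (fun k => -1 * freq N a k)). now apply decays_scal, decays_freq.
Qed.

Lemma is_derive_sin_series (N : nat) (h : R) (a : nat -> R) (x : R) : decays a ->
  is_derive (sin_series N h a) x (cos_series N h (freq N a) x).
Proof.
  intros H. unfold cos_series, sin_series.
  apply is_derive_Series with
    (f := fun k x => a k * sin (INR (k * N) * (x - h)))
    (df := fun k x => freq N a k * cos (INR (k * N) * (x - h)))
    (ddf := fun k x => - freq N (freq N a) k * sin (INR (k * N) * (x - h)))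
    (M := fun k => Rabs (freq N (freq N a) k)).
  - intros k z. unfold freq. generalize (INR (k * N)). intros w. auto_derive; auto. unfold Rminus. ring.
  - intros k z. unfold freq. generalize (INR (k * N)). intros w. auto_derive; auto. unfold Rminus. ring.
  - intros k z. rewrite <- (Rabs_Ropp (freq N (freq N a) k)). apply Rabs_mul_sin_le.
  - now apply decays_ex, decays_freq, decays_freq.
  - intros z. now apply ex_sin_series.
  - apply (ex_cos_series N h (freq N a)). now apply decays_freq.
Qed.

Lemma Derive_cos_series (N : nat) (h : R) (a : nat -> R) : decays a ->
  Derive (cos_series N h a) = sin_series N h (fun k => -1 * freq N a k).
Proof.
  intros H. apply functional_extensionality. intros x.
  now apply is_derive_unique, is_derive_cos_series.
Qed.

Lemma Derive_sin_series (N : nat) (h : R) (a : nat -> R) : decays a ->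
  Derive (sin_series N h a) = cos_series N h (freq N a).
Proof.
  intros H. apply functional_extensionality. intros x.
  now apply is_derive_unique, is_derive_sin_series.
Qed.

Lemma continuous_cos_series (N : nat) (h : R) (a : nat -> R) (x : R) :
  decays a -> continuous (cos_series N h a) x.
Proof.
  intros H. apply (ex_derive_continuous (V := R_NormedModule)).
  eexists. now apply is_derive_cos_series.
Qed.

Lemma continuous_sin_series (N : nat) (h : R) (a : nat -> R) (x : R) :
  decays a -> continuous (sin_series N h a) x.
Proof.
  intros H. apply (ex_derive_continuous (V := R_NormedModule)).
  eexists. now apply is_derive_sin_series.
Qed.

Lemma ex_freq_bound (N : nat) (a : nat -> R) : decays a ->
  ex_series (fun k => Rabs (a k) * (4 * INR (k * N))).
Proof.
  intros H. apply ex_series_Rext with (fun k => 4 * Rabs (freq N a k)).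
  - intros k. unfold freq. rewrite Rabs_mult, (Rabs_right (INR (k * N))).
    + ring.
    + apply Rle_ge, pos_INR.
  - now apply ex_series_Rscal, decays_ex, decays_freq.
Qed.

Lemma has_hilbert_cos_series (N : nat) (h : R) (a : nat -> R) : decays a ->
  exists M, has_hilbert (cos_series N h a) (sin_series N h a) M.
Proof.
  intros H. eexists. apply has_hilbert_Series.
  - intros k. apply has_hilbert_scal, has_hilbert_cos.
  - now apply ex_freq_bound.
  - intros x. now apply ex_cos_series.
Qed.

(** Mode 0 is invisible in a sine series but would leave the constant [- a 0] in the cosine series;
    hence the condition on [a 0]. *)
Lemma has_hilbert_sin_series (N : nat) (h : R) (a : nat -> R) :
  N <> 0%nat -> a 0%nat = 0 -> decays a ->
  exists M, has_hilbert (sin_series N h a) (cos_series N h (fun k => -1 * a k)) M.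
Proof.
  intros HN H0 H. eexists. apply has_hilbert_Series.
  - intros k. apply has_hilbert_ext with (f := fun y => a k * sin (INR (k * N) * (y - h)))
      (g := fun x => a k * - cos (INR (k * N) * (x - h))) (M := Rabs (a k) * (4 * INR (k * N))).
    { reflexivity. } { intros x. ring. }
    destruct k as [|k].
    + rewrite H0. generalize (has_hilbert_scal 0 _ _ _ (has_hilbert_cos (0 * N) h)).
      apply has_hilbert_ext; intros x; ring.
    + apply has_hilbert_scal, has_hilbert_sin. lia.
  - now apply ex_freq_bound.
  - intros x. now apply ex_sin_series.
Qed.

Lemma hilbert_dom_cos_series (N : nat) (h : R) (a : nat -> R) :
  decays a -> hilbert_dom (cos_series N h a).
Proof.
  intros H. destruct (has_hilbert_cos_series N h a H) as [M HM].
  apply (has_hilbert_dom _ _ _ (cos_series_periodic N h a)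
    (fun y => continuous_cos_series N h a y H) HM).
Qed.

Lemma hilbert_cos_series (N : nat) (h : R) (a : nat -> R) :
  decays a -> hilbert (cos_series N h a) = sin_series N h a.
Proof.
  intros H. destruct (has_hilbert_cos_series N h a H) as [M HM].
  apply (has_hilbert_eq _ _ _ (cos_series_periodic N h a)
    (fun y => continuous_cos_series N h a y H) HM).
Qed.

Lemma hilbert_dom_sin_series (N : nat) (h : R) (a : nat -> R) :
  N <> 0%nat -> a 0%nat = 0 -> decays a -> hilbert_dom (sin_series N h a).
Proof.
  intros HN H0 H. destruct (has_hilbert_sin_series N h a HN H0 H) as [M HM].
  apply (has_hilbert_dom _ _ _ (sin_series_periodic N h a)
    (fun y => continuous_sin_series N h a y H) HM).
Qed.

Lemma hilbert_sin_series (N : nat) (h : R) (a : nat -> R) :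
  N <> 0%nat -> a 0%nat = 0 -> decays a ->
  hilbert (sin_series N h a) = cos_series N h (fun k => -1 * a k).
Proof.
  intros HN H0 H. destruct (has_hilbert_sin_series N h a HN H0 H) as [M HM].
  apply (has_hilbert_eq _ _ _ (sin_series_periodic N h a)
    (fun y => continuous_sin_series N h a y H) HM).
Qed.

Lemma freq_0 (N : nat) (a : nat -> R) : freq N a 0 = 0.
Proof. unfold freq. simpl. ring. Qed.

Lemma zygmund_cos_series (N : nat) (h : R) (a : nat -> R) : N <> 0%nat -> decays a ->
  zygmund (cos_series N h a) = cos_series N h (freq N a).
Proof.
  intros HN H. unfold zygmund.
  rewrite Derive_cos_series, hilbert_sin_series; auto.
  - f_equal. apply functional_extensionality. intros k. ring.
  - rewrite freq_0. ring.
  - now apply decays_scal, decays_freq.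
Qed.

Lemma zygmund_sin_series (N : nat) (h : R) (a : nat -> R) : decays a ->
  zygmund (sin_series N h a) = sin_series N h (freq N a).
Proof.
  intros H. unfold zygmund. rewrite Derive_sin_series, hilbert_cos_series; auto.
  now apply decays_freq.
Qed.

Lemma zygmund_dom_cos_series (N : nat) (h : R) (a : nat -> R) : N <> 0%nat -> decays a ->
  zygmund_dom (cos_series N h a).
Proof.
  intros HN H. split.
  - intros x. eexists. now apply is_derive_cos_series.
  - rewrite Derive_cos_series; auto. apply hilbert_dom_sin_series; auto.
    + rewrite freq_0. ring.
    + now apply decays_scal, decays_freq.
Qed.

Lemma zygmund_dom_sin_series (N : nat) (h : R) (a : nat -> R) : decays a ->
  zygmund_dom (sin_series N h a).
Proof.
  intros H. split.
  - intros x. eexists. now apply is_derive_sin_series.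
  - rewrite Derive_sin_series; auto. apply hilbert_dom_cos_series; auto. now apply decays_freq.
Qed.

(** * Products of series, correlations and the commutator *)

Definition correlation (a b : nat -> R) (n : nat) : R :=
  Series (fun l => a (n + l)%nat * b l).

Definition convolution (a b : nat -> R) (n : nat) : R :=
  sum_f_R0 (fun k => a k * b (n - k)%nat) n.

(** The majorant has product form in [n] and [l], as the interchange of sums demands: the decay of
    [a] is kept in [n] only, and [b] supplies the decay in [l]. *)
Lemma correlation_dom (a b : nat -> R) : decays a -> decays b ->
  exists A, decays A /\ forall n l, Rabs (a (n + l)%nat * b l) <= A n * Rabs (b l).
Proof.
  intros (C & r & Hr & H) _. exists (fun n => Rabs C * r ^ n). split.
  - exists (Rabs C), r. split; auto. intros k. right.
    rewrite Rabs_mult, Rabs_Rabsolu, (Rabs_right (r ^ k)); auto.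
    apply Rle_ge, pow_le; lra.
  - intros n l. rewrite Rabs_mult. apply Rmult_le_compat_r. apply Rabs_pos.
    eapply Rle_trans; [apply H|]. rewrite pow_add.
    assert (P : 0 <= r ^ n) by (apply pow_le; lra).
    assert (Q : 0 <= r ^ l <= 1).
    { split. apply pow_le; lra. rewrite <- (pow1 l). apply pow_incr; lra. }
    assert (Y := Rabs_pos C). assert (Z := Rle_abs C).
    apply Rle_trans with (Rabs C * (r ^ n * r ^ l)).
    + apply Rmult_le_compat_r; auto. now apply Rmult_le_pos.
    + apply Rmult_le_compat_l; auto. rewrite <- (Rmult_1_r (r ^ n)) at 2.
      apply Rmult_le_compat_l; lra.
Qed.

Lemma decays_correlation (a b : nat -> R) : decays a -> decays b -> decays (correlation a b).
Proof.
  intros Ha Hb. destruct (correlation_dom a b Ha Hb) as (A & HA & H).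
  apply decays_le with (fun n => Series (fun l => Rabs (b l)) * A n).
  2:{ now apply decays_scal. }
  intros n. eapply Rle_trans.
  - apply Rabs_Series_le. apply H. now apply ex_series_Rscal, decays_ex.
  - rewrite Series_scal_l, Rmult_comm. apply Rle_abs.
Qed.

(** A double sum is regrouped along k - l. Truncated subtraction sends every pair with k <= l to sin
    0 = 0, so for fixed [l] the first [l] terms drop out and k = n + l reindexes the rest. *)
Lemma sin_correlation (N : nat) (h : R) (a b : nat -> R) (x : R) :
  decays a -> decays b ->
  Series (fun k => Series (fun l => a k * b l * sin (INR ((k - l) * N) * (x - h))))
  = sin_series N h (correlation a b) x.
Proof.
  intros Ha Hb.
  set (s := fun n => sin (INR (n * N) * (x - h))).
  change (Series (fun k => Series (fun l => a k * b l * s (k - l)%nat)) =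
    Series (fun n => Series (fun l => a (n + l)%nat * b l) * s n)).
  assert (Ea := decays_ex a Ha). assert (Eb := decays_ex b Hb).
  rewrite (is_series_unique _ _ (is_series_swap (fun k l => a k * b l * s (k - l)%nat)
    (fun k => Rabs (a k)) (fun l => Rabs (b l))
    (fun k l => Rle_trans _ _ _ (Rabs_mul_sin_le _ _) (Req_le _ _ (Rabs_mult _ _))) Ea Eb)).
  destruct (correlation_dom a b Ha Hb) as (A & HA & H).
  assert (EA : ex_series A).
  { now apply decays_ex_series. }
  rewrite (Series_ext (fun n => Series (fun l => a (n + l)%nat * b l) * s n)
    (fun n => Series (fun l => a (n + l)%nat * b l * s n)))
    by (intros n; now rewrite Series_scal_r).
  rewrite (is_series_unique _ _ (is_series_swap (fun n l => a (n + l)%nat * b l * s n)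
    A (fun l => Rabs (b l))
    (fun n l => Rle_trans _ _ _ (Rabs_mul_sin_le _ _) (H n l)) EA Eb)).
  apply Series_ext. intros l.
  assert (E0 : forall k, (k <= l)%nat -> a k * b l * s (k - l)%nat = 0).
  { intros k Hk. unfold s. replace (k - l)%nat with 0%nat by lia. simpl.
    rewrite Rmult_0_l, sin_0. ring. }
  destruct l as [|l].
  - apply Series_ext. intros k. now rewrite Nat.sub_0_r, Nat.add_0_r.
  - rewrite (Series_incr_n _ (S l)); [| lia |].
    + rewrite (sum_eq _ (fun _ => 0)); [| intros i Hi; apply E0; simpl in Hi; lia].
      rewrite sum_eq_R0 by auto. rewrite Rplus_0_l. apply Series_ext. intros k.
      rewrite (Nat.add_comm (S l) k). now replace (k + S l - S l)%nat with k by lia.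
    + apply ex_series_dom with (fun k => Rabs (a k) * Rabs (b (S l))).
      * intros k. eapply Rle_trans; [apply Rabs_mul_sin_le|]. rewrite Rabs_mult. lra.
      * now apply ex_series_scal_r.
Qed.

Lemma has_hilbert_le (f g : R -> R) (M M' : R) :
  M <= M' -> has_hilbert f g M -> has_hilbert f g M'.
Proof. intros H [H1 H2]. split; auto. intros x z. eapply Rle_trans; eauto. Qed.

(** Half the sum of the sines of p + q and |p - q| is cos p sin q if p <= q, and sin p cos q
    otherwise; the sine of the truncated [p - q] is the discrepancy. In the proof [p - q + (q - p)]
    is |p - q|. The bound is put in product form so that it can be summed over [p] and [q]
    separately. *)
Lemma has_hilbert_cos_cos (p q : nat) (h : R) :
  has_hilbert (fun y => cos (INR p * (y - h)) * cos (INR q * (y - h)))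
    (fun x => cos (INR p * (x - h)) * sin (INR q * (x - h)) + sin (INR (p - q) * (x - h)))
    (4 * (1 + INR p) * (1 + INR q)).
Proof.
  assert (Hp := pos_INR p). assert (Hq := pos_INR q).
  generalize (has_hilbert_plus _ _ _ _ _ _
    (has_hilbert_scal (/ 2) _ _ _ (has_hilbert_cos (p + q) h))
    (has_hilbert_scal (/ 2) _ _ _ (has_hilbert_cos (p - q + (q - p)) h))).
  rewrite (Rabs_right (/ 2)) by lra.
  intros H. apply has_hilbert_le with (M' := 4 * (1 + INR p) * (1 + INR q)) in H.
  - revert H. destruct (Nat.le_ge_cases p q) as [L|L].
    + replace (p - q)%nat with 0%nat by lia.
      apply has_hilbert_ext; intros x; rewrite !plus_INR, ?minus_INR by auto; simpl INR;
        rewrite !Rplus_0_l, ?Rmult_0_l, ?sin_0;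
        rewrite Rmult_plus_distr_r, Rmult_minus_distr_r;
        rewrite ?cos_plus, ?cos_minus, ?sin_plus, ?sin_minus; field.
    + replace (q - p)%nat with 0%nat by lia.
      apply has_hilbert_ext; intros x; rewrite !plus_INR, ?minus_INR by auto; simpl INR;
        rewrite !Rplus_0_r;
        rewrite Rmult_plus_distr_r, Rmult_minus_distr_r;
        rewrite ?cos_plus, ?cos_minus, ?sin_plus, ?sin_minus; field.
  - rewrite !plus_INR.
    assert (INR (p - q) + INR (q - p) <= INR p + INR q).
    { rewrite <- !plus_INR. apply le_INR. lia. }
    nra.
Qed.

(** The first summand of the transform is f H(g), so the correlation is the whole commutator: only
    pairs of modes k > l contribute to it. *)
Lemma has_hilbert_product (N : nat) (h : R) (a b : nat -> R) : decays a -> decays b ->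
  exists M, has_hilbert (fun y => cos_series N h a y * cos_series N h b y)
    (fun x => cos_series N h a x * sin_series N h b x
              + sin_series N h (correlation a b) x) M.
Proof.
  intros Ha Hb.
  set (c := fun k x => cos (INR (k * N) * (x - h))).
  set (s := fun k x => sin (INR (k * N) * (x - h))).
  set (w := fun k => 1 + INR (k * N)).
  assert (Hw : forall k, 0 <= w k).
  { intros k. unfold w. assert (X := pos_INR (k * N)). lra. }
  assert (W : forall a, decays a -> ex_series (fun k => Rabs (a k) * w k)).
  { intros u Hu. apply ex_series_Rext with (fun k => Rabs (u k) + Rabs (freq N u k)).
    - intros k. unfold w, freq. rewrite Rabs_mult, (Rabs_right (INR (k * N))). ring.
      apply Rle_ge, pos_INR.
    - apply ex_series_Rplus; apply decays_ex; auto. now apply decays_freq. }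
  eexists.
  apply has_hilbert_ext with
    (f := fun y => Series (fun k => Series (fun l => a k * b l * (c k y * c l y))))
    (g := fun x => Series (fun k => Series (fun l => a k * b l * (c k x * s l x + s (k - l)%nat x)))).
  - intros x. unfold cos_series. rewrite <- Series_scal_r. apply Series_ext. intros k.
    rewrite <- Series_scal_l. apply Series_ext. intros l. unfold c. ring.
  - intros x. rewrite <- sin_correlation; auto.
    assert (E1 : forall k, ex_series (fun l => a k * b l * (c k x * s l x))).
    { intros k. apply ex_series_dom with (fun l => Rabs (a k) * Rabs (b l)).
      - intros l. replace (a k * b l * (c k x * s l x)) with ((a k * b l * s l x) * c k x) by ring.
        eapply Rle_trans; [apply Rabs_mul_cos_le|].
        eapply Rle_trans; [apply Rabs_mul_sin_le|]. rewrite Rabs_mult. lra.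
      - now apply ex_series_Rscal, decays_ex. }
    assert (E2 : forall k, ex_series (fun l => a k * b l * s (k - l)%nat x)).
    { intros k. apply ex_series_dom with (fun l => Rabs (a k) * Rabs (b l)).
      - intros l. eapply Rle_trans; [apply Rabs_mul_sin_le|]. rewrite Rabs_mult. lra.
      - now apply ex_series_Rscal, decays_ex. }
    assert (F : forall k, Series (fun l => a k * b l * (c k x * s l x))
                 = a k * c k x * sin_series N h b x).
    { intros k. unfold sin_series. rewrite <- Series_scal_l. apply Series_ext.
      intros l. unfold s. ring. }
    rewrite (Series_ext _ (fun k => a k * c k x * sin_series N h b x +
       Series (fun l => a k * b l * s (k - l)%nat x))).
    + rewrite Series_plus.
      * now rewrite Series_scal_r.
      * apply ex_series_scal_r. now apply ex_cos_series.
      * apply ex_series_dom with (fun k => Rabs (a k) * Series (fun l => Rabs (b l))).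
        -- intros k. rewrite <- Series_scal_l. apply Rabs_Series_le.
           ++ intros l. eapply Rle_trans; [apply Rabs_mul_sin_le|]. rewrite Rabs_mult. lra.
           ++ now apply ex_series_Rscal, decays_ex.
        -- now apply ex_series_scal_r, decays_ex.
    + intros k. rewrite <- F, <- Series_plus; auto. apply Series_ext. intros l. ring.
  - apply has_hilbert_Series with
      (M := fun k => Series (fun l => Rabs (a k * b l) * (4 * w k * w l))).
    + intros k. apply has_hilbert_Series.
      * intros l. apply has_hilbert_scal.
        unfold c, s, w. rewrite Nat.mul_sub_distr_r. apply has_hilbert_cos_cos.
      * apply ex_series_Rext with (fun l => 4 * (Rabs (a k) * w k) * (Rabs (b l) * w l)).
        { intros l. rewrite Rabs_mult. ring. }
        apply ex_series_Rscal. auto.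
      * intros x. apply ex_series_dom with (fun l => Rabs (a k) * Rabs (b l)).
        -- intros l. replace (a k * b l * (c k x * c l x)) with ((a k * b l * c l x) * c k x) by ring.
           eapply Rle_trans; [apply Rabs_mul_cos_le|].
           eapply Rle_trans; [apply Rabs_mul_cos_le|]. rewrite Rabs_mult. lra.
        -- now apply ex_series_Rscal, decays_ex.
    + apply ex_series_Rext with (fun k => 4 * (Rabs (a k) * w k) * Series (fun l => Rabs (b l) * w l)).
      * intros k. rewrite <- Series_scal_l. apply Series_ext. intros l. rewrite Rabs_mult. ring.
      * apply ex_series_scal_r, ex_series_Rscal. auto.
    + intros x. apply ex_series_Rext with (fun k => a k * c k x * cos_series N h b x).
      * intros k. unfold cos_series. rewrite <- Series_scal_l. apply Series_ext.
        intros l. unfold c. ring.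
      * apply ex_series_scal_r. now apply ex_cos_series.
Qed.

Lemma cos_series_mul_periodic (N : nat) (h : R) (a b : nat -> R) :
  periodic (fun y => cos_series N h a y * cos_series N h b y).
Proof. intros x. now rewrite !cos_series_periodic. Qed.

Lemma continuous_cos_series_mul (N : nat) (h : R) (a b : nat -> R) (x : R) :
  decays a -> decays b -> continuous (fun y => cos_series N h a y * cos_series N h b y) x.
Proof.
  intros Ha Hb. apply (continuous_mult (K := R_AbsRing)); now apply continuous_cos_series.
Qed.

Lemma hilbert_dom_product (N : nat) (h : R) (a b : nat -> R) : decays a -> decays b ->
  hilbert_dom (fun y => cos_series N h a y * cos_series N h b y).
Proof.
  intros Ha Hb. destruct (has_hilbert_product N h a b Ha Hb) as [M HM].
  apply (has_hilbert_dom _ _ _ (cos_series_mul_periodic N h a b)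
    (fun y => continuous_cos_series_mul N h a b y Ha Hb) HM).
Qed.

Lemma hilbert_product (N : nat) (h : R) (a b : nat -> R) (x : R) : decays a -> decays b ->
  hilbert (fun y => cos_series N h a y * cos_series N h b y) x
  = cos_series N h a x * sin_series N h b x + sin_series N h (correlation a b) x.
Proof.
  intros Ha Hb. destruct (has_hilbert_product N h a b Ha Hb) as [M HM].
  now rewrite (has_hilbert_eq _ _ _ (cos_series_mul_periodic N h a b)
    (fun y => continuous_cos_series_mul N h a b y Ha Hb) HM).
Qed.

Lemma commutator_cos_series (N : nat) (h : R) (a b : nat -> R) (x : R) :
  decays a -> decays b ->
  commutator hilbert (cos_series N h a) (cos_series N h b) x
  = sin_series N h (correlation a b) x.
Proof.
  intros Ha Hb. unfold commutator. rewrite hilbert_product, hilbert_cos_series; auto. ring.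
Qed.

(* Adding the Cauchy products taken in both orders turns
   [sin k cos (n-k) + cos k sin (n-k)] into [sin n]. *)
Lemma cos_mul_sin_series (N : nat) (h : R) (a : nat -> R) (x : R) : decays a ->
  is_series (fun n => / 2 * convolution a a n * sin (INR (n * N) * (x - h)))
    (cos_series N h a x * sin_series N h a x).
Proof.
  intros Ha.
  set (c := fun k => a k * cos (INR (k * N) * (x - h))).
  set (s := fun k => a k * sin (INR (k * N) * (x - h))).
  assert (Ec : ex_series (fun k => Rabs (c k))).
  { apply ex_series_dom with (fun k => Rabs (a k)); [|now apply decays_ex].
    intros k. rewrite Rabs_Rabsolu. apply Rabs_mul_cos_le. }
  assert (Es : ex_series (fun k => Rabs (s k))).
  { apply ex_series_dom with (fun k => Rabs (a k)); [|now apply decays_ex].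
    intros k. rewrite Rabs_Rabsolu. apply Rabs_mul_sin_le. }
  assert (Sc := Series_correct c (ex_series_Rabs c Ec)).
  assert (Ss := Series_correct s (ex_series_Rabs s Es)).
  generalize (is_series_scal_l (V := R_NormedModule) (/ 2) _ _
    (is_series_plus (V := R_NormedModule) _ _ _ _
      (is_series_mult c s _ _ Sc Ss Ec Es) (is_series_mult s c _ _ Ss Sc Es Ec))).
  intros H.
  replace (cos_series N h a x * sin_series N h a x) with
    (/ 2 * (Series c * Series s + Series s * Series c)).
  2:{ unfold cos_series, sin_series. fold c s. field. }
  revert H. apply is_series_ext. intros n.
  unfold scal, plus; simpl; unfold mult; simpl. rewrite <- sum_plus. unfold convolution.
  rewrite Rmult_assoc. f_equal. rewrite Rmult_comm, scal_sum. apply sum_eq.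
  intros k Hk. unfold c, s.
  replace (INR (n * N) * (x - h)) with (INR (k * N) * (x - h) + INR ((n - k) * N) * (x - h)).
  - rewrite sin_plus. ring.
  - rewrite <- Rmult_plus_distr_r, <- plus_INR, <- Nat.mul_add_distr_r.
    now replace (k + (n - k))%nat with n by lia.
Qed.

(** * Traveling waves as cosine series *)

Lemma Derive_n_2 (f : R -> R) : Derive_n f 2 = Derive (Derive f).
Proof. reflexivity. Qed.

Lemma Derive_n_3 (f : R -> R) : Derive_n f 3 = Derive (Derive (Derive f)).
Proof. reflexivity. Qed.

Lemma C3_cos_series (N : nat) (h : R) (a : nat -> R) : decays a -> C3 (cos_series N h a).
Proof.
  intros H.
  assert (H1 := decays_scal (-1) _ (decays_freq N a H)).
  assert (H2 := decays_freq N _ H1).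
  assert (H3 := decays_scal (-1) _ (decays_freq N _ H2)).
  split.
  - intros k x Hk. destruct k as [|[|[|[|k]]]]; [exact I| | | |lia]; simpl.
    + eexists. now apply is_derive_cos_series.
    + change (ex_derive (Derive (cos_series N h a)) x).
      rewrite Derive_cos_series by auto. eexists. now apply is_derive_sin_series.
    + change (ex_derive (Derive (Derive (cos_series N h a))) x).
      rewrite Derive_cos_series, Derive_sin_series by auto.
      eexists. now apply is_derive_cos_series.
  - intros x. rewrite Derive_n_3, Derive_cos_series, Derive_sin_series, Derive_cos_series by auto.
    now apply continuous_sin_series.
Qed.

Lemma cos_series_diff_le (N : nat) (h : R) (a a' m : nat -> R) (x : R) :
  decays a -> decays a' -> (forall k, Rabs (a k - a' k) <= m k) -> ex_series m ->
  Rabs (cos_series N h a x - cos_series N h a' x) <= Series m.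
Proof.
  intros Ha Ha' H Hm. unfold cos_series.
  rewrite <- Series_minus by now apply ex_cos_series.
  apply Rabs_Series_le; auto. intros k. rewrite <- Rmult_minus_distr_r.
  eapply Rle_trans; [apply Rabs_mul_cos_le | apply H].
Qed.

Lemma sin_series_diff_le (N : nat) (h : R) (a a' m : nat -> R) (x : R) :
  decays a -> decays a' -> (forall k, Rabs (a k - a' k) <= m k) -> ex_series m ->
  Rabs (sin_series N h a x - sin_series N h a' x) <= Series m.
Proof.
  intros Ha Ha' H Hm. unfold sin_series.
  rewrite <- Series_minus by now apply ex_sin_series.
  apply Rabs_Series_le; auto. intros k. rewrite <- Rmult_minus_distr_r.
  eapply Rle_trans; [apply Rabs_mul_sin_le | apply H].
Qed.

Lemma freq_diff_le (N : nat) (a a' m : nat -> R) :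
  (forall k, Rabs (a k - a' k) <= m k) ->
  forall k, Rabs (freq N a k - freq N a' k) <= freq N m k.
Proof.
  intros H k. unfold freq. rewrite <- Rmult_minus_distr_l, Rabs_mult, Rabs_right.
  - apply Rmult_le_compat_l; auto. apply pos_INR.
  - apply Rle_ge, pos_INR.
Qed.

Lemma opp_diff_le (a a' m : nat -> R) :
  (forall k, Rabs (a k - a' k) <= m k) ->
  forall k, Rabs (-1 * a k - -1 * a' k) <= m k.
Proof.
  intros H k. replace (-1 * a k - -1 * a' k) with (- (a k - a' k)) by ring.
  now rewrite Rabs_Ropp.
Qed.

(** Coefficients that move by at most [d * m k] move the series by at most [d * K] in C^3. Since [K]
    does not depend on the sequences, this yields the continuity of the curve. *)
Lemma Derive_n_cos_series_diff_le (N : nat) (h : R) (m : nat -> R) : decays m ->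
  exists K, 0 <= K /\ forall (a a' : nat -> R) (d : R), 0 <= d -> decays a -> decays a' ->
    (forall k, Rabs (a k - a' k) <= d * m k) ->
    forall k x, (k <= 3)%nat ->
    Rabs (Derive_n (cos_series N h a) k x - Derive_n (cos_series N h a') k x) <= d * K.
Proof.
  intros Hm.
  assert (D1 := decays_freq N m Hm). assert (D2 := decays_freq N _ D1).
  assert (D3 := decays_freq N _ D2).
  set (S0 := Rabs (Series m)). set (S1 := Rabs (Series (freq N m))).
  set (S2 := Rabs (Series (freq N (freq N m)))).
  set (S3 := Rabs (Series (freq N (freq N (freq N m))))).
  assert (P0 : 0 <= S0) by apply Rabs_pos. assert (P1 : 0 <= S1) by apply Rabs_pos.
  assert (P2 : 0 <= S2) by apply Rabs_pos. assert (P3 : 0 <= S3) by apply Rabs_pos.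
  exists (S0 + S1 + S2 + S3). split. lra.
  intros a a' d Hd Ha Ha' H k x Hk.
  assert (Q : forall u S v, Rabs (Series u) = S -> v <= Series (fun k => d * u k) ->
      S <= S0 + S1 + S2 + S3 -> v <= d * (S0 + S1 + S2 + S3)).
  { intros u S v HS Hv HL. rewrite Series_scal_l in Hv. assert (X := Rle_abs (Series u)).
    rewrite HS in X. eapply Rle_trans; [apply Hv|]. apply Rmult_le_compat_l; lra. }
  assert (F : forall u, freq N (fun k => d * u k) = fun k => d * freq N u k).
  { intros u. apply functional_extensionality. intros j. unfold freq. ring. }
  assert (A1 := decays_scal (-1) _ (decays_freq N a Ha)).
  assert (A2 := decays_freq N _ A1).
  assert (A3 := decays_scal (-1) _ (decays_freq N _ A2)).
  assert (B1 := decays_scal (-1) _ (decays_freq N a' Ha')).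
  assert (B2 := decays_freq N _ B1).
  assert (B3 := decays_scal (-1) _ (decays_freq N _ B2)).
  assert (H1 := opp_diff_le _ _ _ (freq_diff_le N _ _ _ H)).
  assert (H2 := freq_diff_le N _ _ _ H1).
  assert (H3 := opp_diff_le _ _ _ (freq_diff_le N _ _ _ H2)).
  destruct k as [|[|[|[|k]]]]; [| | | |lia].
  - apply (Q m S0); auto; [|lra]. simpl. apply cos_series_diff_le; auto.
    now apply decays_ex_series, decays_scal.
  - apply (Q (freq N m) S1); auto; [|lra].
    change (Rabs (Derive (cos_series N h a) x - Derive (cos_series N h a') x)
      <= Series (fun k => d * freq N m k)).
    rewrite !Derive_cos_series by auto. rewrite F in H1.
    apply sin_series_diff_le; auto. now apply decays_ex_series, decays_scal.
  - apply (Q (freq N (freq N m)) S2); auto; [|lra].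
    rewrite !Derive_n_2, !Derive_cos_series, !Derive_sin_series by auto.
    rewrite !F in H2.
    apply cos_series_diff_le; auto. now apply decays_ex_series, decays_scal.
  - apply (Q (freq N (freq N (freq N m))) S3); auto; [|lra].
    rewrite !Derive_n_3, !Derive_cos_series, !Derive_sin_series, !Derive_cos_series by auto.
    rewrite !F in H3.
    apply sin_series_diff_le; auto. now apply decays_ex_series, decays_scal.
Qed.

(** Time enters through the phase alone, so at each instant the wave is a series with the same
    coefficients. *)
Lemma traveling_cos_series (N : nat) (a : nat -> R) (c t : R) :
  traveling_wave (cos_series N 0 a) c t = cos_series N (c * t) a.
Proof.
  apply functional_extensionality. intros x. unfold traveling_wave, cos_series.
  apply Series_ext. intros k. now rewrite Rminus_0_r.
Qed.

Lemma is_derive_traveling_cos_series (N : nat) (a : nat -> R) (c t x : R) : decays a ->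
  is_derive (fun tau => traveling_wave (cos_series N 0 a) c tau x) t
    (sin_series N (c * t) (fun k => c * freq N a k) x).
Proof.
  intros Ha. unfold traveling_wave.
  replace (sin_series N (c * t) (fun k => c * freq N a k) x)
    with (scal (- c) (sin_series N 0 (fun k => -1 * freq N a k) (x - c * t))).
  - apply (is_derive_comp (V := R_NormedModule) (cos_series N 0 a) (fun tau => x - c * tau)).
    + now apply is_derive_cos_series.
    + auto_derive; auto. ring.
  - unfold scal; simpl; unfold mult; simpl. rewrite !sin_series_scal.
    unfold sin_series. rewrite (Series_ext (fun k => freq N a k * sin (INR (k * N) * (x - c * t - 0)))
      (fun k => freq N a k * sin (INR (k * N) * (x - c * t)))).
    + ring.
    + intros k. now rewrite Rminus_0_r.
Qed.

Lemma time_derive_traveling_cos_series (N : nat) (a : nat -> R) (c t : R) : decays a ->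
  time_derive (traveling_wave (cos_series N 0 a) c) t
  = sin_series N (c * t) (fun k => c * freq N a k).
Proof.
  intros Ha. apply functional_extensionality. intros x.
  now apply is_derive_unique, is_derive_traveling_cos_series.
Qed.

Lemma well_defined_traveling_cos_series (N : nat) (a : nat -> R) (c t : R) :
  N <> 0%nat -> decays a -> well_defined_at (traveling_wave (cos_series N 0 a) c) t.
Proof.
  intros HN Ha.
  assert (D1 := decays_freq N a Ha). assert (D2 := decays_freq N _ D1).
  assert (D3 := decays_freq N _ D2). assert (D1' := decays_scal (-1) _ D1).
  unfold well_defined_at. cbv zeta.
  rewrite time_derive_traveling_cos_series, traveling_cos_series by auto.
  rewrite !zygmund_cos_series by auto.
  repeat match goal with |- _ /\ _ => split end;
    try match goal with |- zygmund_dom (cos_series _ _ _) => now apply zygmund_dom_cos_series end.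
  - apply cos_series_periodic.
  - intros x. eexists. now apply is_derive_traveling_cos_series.
  - apply zygmund_dom_sin_series. now apply decays_scal.
  - now apply hilbert_dom_cos_series.
  - intros x. apply (C3_cos_series N (c * t) a Ha). lia.
  - rewrite Derive_n_2, Derive_cos_series, Derive_sin_series by auto.
    apply hilbert_dom_cos_series. now apply decays_freq.
  - replace (fun y => cos_series N (c * t) (freq N a) y ^ 2)
      with (fun y => cos_series N (c * t) (freq N a) y * cos_series N (c * t) (freq N a) y)
      by (apply functional_extensionality; intros y; ring).
    now apply hilbert_dom_product.
  - split; [now apply hilbert_dom_product | now apply hilbert_dom_cos_series].
  - split; [now apply hilbert_dom_product | now apply hilbert_dom_cos_series].
Qed.

(** Every term of the equation is odd about the point [c * t], hence a sine series of the same
    phase, and mode 0 imposes no condition. The linear right-hand side changes sign because it is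
    moved to the left. *)
Lemma classical_solution_cos_series (eps alpha0 beta c : R) (N : nat) (a : nat -> R) :
  N <> 0%nat -> decays a ->
  (forall n, n <> 0%nat ->
     c * (2 * freq N a n + alpha0 * freq N (freq N a) n)
     + 1 / eps * (freq N a n - a n + (alpha0 - beta) * freq N (freq N a) n)
     = / 2 * convolution (freq N a) (freq N a) n + correlation (freq N a) (freq N a) n
       - correlation a (freq N a) n
       + (alpha0 - beta) * correlation a (freq N (freq N (freq N a))) n) ->
  forall T, classical_solution eps alpha0 beta T (traveling_wave (cos_series N 0 a) c).
Proof.
  intros HN Ha H T t _. split. { now apply well_defined_traveling_cos_series. }
  assert (D1 := decays_freq N a Ha). assert (D2 := decays_freq N _ D1).
  assert (D3 := decays_freq N _ D2). assert (D1' := decays_scal (-1) _ D1).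
  intros x. unfold wave_equation_at. cbv zeta.
  rewrite time_derive_traveling_cos_series, traveling_cos_series by auto.
  set (h := c * t). clearbody h.
  assert (Sq : (fun y => zygmund (cos_series N h a) y ^ 2)
     = fun y => cos_series N h (freq N a) y * cos_series N h (freq N a) y).
  { apply functional_extensionality. intros y. rewrite zygmund_cos_series by auto. ring. }
  rewrite Sq, hilbert_product by auto.
  rewrite !zygmund_cos_series by auto.
  rewrite !commutator_cos_series by auto.
  rewrite zygmund_sin_series by now apply decays_scal.
  rewrite hilbert_cos_series by auto.
  rewrite Derive_n_2, Derive_cos_series, Derive_sin_series by auto.
  rewrite hilbert_cos_series by now apply decays_freq.
  assert (Cv := cos_mul_sin_series N h (freq N a) x D1).
  rewrite <- (is_series_unique _ _ Cv).
  assert (E0 := ex_intro (fun l => is_series _ l) _ Cv). cbv beta in E0.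
  assert (E1 := ex_sin_series N h a x Ha).
  assert (E2 := ex_sin_series N h _ x D1).
  assert (E3 := ex_sin_series N h _ x D2).
  assert (C1 := ex_sin_series N h _ x (decays_correlation _ _ D1 D1)).
  assert (C2 := ex_sin_series N h _ x (decays_correlation _ _ Ha D1)).
  assert (C3 := ex_sin_series N h _ x (decays_correlation _ _ Ha D3)).
  rewrite !sin_series_scal.
  replace (freq N (fun k => c * freq N a k)) with (fun k => c * freq N (freq N a) k)
    by (apply functional_extensionality; intros k; unfold freq; ring).
  replace (freq N (fun k => -1 * freq N a k)) with (fun k => -1 * freq N (freq N a) k)
    by (apply functional_extensionality; intros k; unfold freq; ring).
  rewrite !sin_series_scal.
  assert (L : Series (fun n => c * 2 * (freq N a n * sin (INR (n * N) * (x - h))) + c * alpha0 * (freq N (freq N a) n * sin (INR (n * N) * (x - h))))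
    = Series (fun n => 1 / eps * -1 * (freq N a n * sin (INR (n * N) * (x - h))) + 1 / eps * (a n * sin (INR (n * N) * (x - h)))
         + - (1 / eps * (alpha0 - beta)) * (freq N (freq N a) n * sin (INR (n * N) * (x - h)))
         + / 2 * convolution (freq N a) (freq N a) n * sin (INR (n * N) * (x - h))
         + correlation (freq N a) (freq N a) n * sin (INR (n * N) * (x - h))
         + -1 * (correlation a (freq N a) n * sin (INR (n * N) * (x - h)))
         + (alpha0 - beta) * (correlation a (freq N (freq N (freq N a))) n * sin (INR (n * N) * (x - h))))).
  { apply Series_ext. intros [|n].
    - simpl (0 * N)%nat. simpl INR. rewrite Rmult_0_l, sin_0. ring.
    - assert (X := H (S n) (Nat.neq_succ_0 n)).
      replace (1 / eps * -1 * (freq N a (S n) * sin (INR (S n * N) * (x - h))) + 1 / eps * (a (S n) * sin (INR (S n * N) * (x - h))) +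
        - (1 / eps * (alpha0 - beta)) * (freq N (freq N a) (S n) * sin (INR (S n * N) * (x - h))) +
        / 2 * convolution (freq N a) (freq N a) (S n) * sin (INR (S n * N) * (x - h)) +
        correlation (freq N a) (freq N a) (S n) * sin (INR (S n * N) * (x - h)) +
        -1 * (correlation a (freq N a) (S n) * sin (INR (S n * N) * (x - h))) +
        (alpha0 - beta) * (correlation a (freq N (freq N (freq N a))) (S n) * sin (INR (S n * N) * (x - h))))
      with ((/ 2 * convolution (freq N a) (freq N a) (S n) +
           correlation (freq N a) (freq N a) (S n) - correlation a (freq N a) (S n) +
           (alpha0 - beta) * correlation a (freq N (freq N (freq N a))) (S n)
           - 1 / eps * (freq N a (S n) - a (S n) + (alpha0 - beta) * freq N (freq N a) (S n))) * sin (INR (S n * N) * (x - h)))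
        by ring.
      rewrite <- X. ring. }
  rewrite !Series_plus in L by repeat first [apply ex_series_Rplus | apply ex_series_Rscal | assumption].
  rewrite !Series_scal_l in L.
  unfold sin_series. lra.
Qed.

(** * Contraction and the quadratic interaction *)

Definition in_ball (u : nat -> R) : Prop := forall j, Rabs (u j) <= 1.

Fixpoint iterate (T : (nat -> R) -> nat -> R) (n : nat) : nat -> R :=
  match n with O => fun _ => 0 | S n => T (iterate T n) end.

(** A telescoping series, taken coordinate by coordinate. *)
Definition limit_point (T : (nat -> R) -> nat -> R) (j : nat) : R :=
  Series (fun n => iterate T (S n) j - iterate T n j).

Definition preserves_ball (T : (nat -> R) -> nat -> R) : Prop :=
  forall u, in_ball u -> in_ball (T u).

(** Contraction in the sup norm, expressed through an arbitrary pointwise bound [r] so that no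
    supremum has to be formed. *)
Definition half_contraction (T : (nat -> R) -> nat -> R) : Prop :=
  forall u v r, in_ball u -> in_ball v ->
    (forall j, Rabs (u j - v j) <= r) -> forall j, Rabs (T u j - T v j) <= r / 2.

Lemma in_ball_iterate (T : (nat -> R) -> nat -> R) (n : nat) :
  preserves_ball T -> in_ball (iterate T n).
Proof.
  intros H. induction n; simpl; auto. intros j. rewrite Rabs_R0. lra.
Qed.

Lemma Rabs_le_eps (x y : R) : (forall e, 0 < e -> Rabs (x - y) <= e) -> x = y.
Proof.
  intros H. apply Rminus_diag_uniq.
  destruct (Req_dec (x - y) 0) as [E|E]; auto.
  apply Rabs_pos_lt in E. specialize (H (Rabs (x - y) / 2)). lra.
Qed.

(** The increments are at most [2 * (/ 2) ^ n] in every coordinate, so the convergence is uniform in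
    [j]. Two consecutive iterates are controlled together, for the passage to the limit in the fixed
    point equation. *)
Lemma iterate_limit (T : (nat -> R) -> nat -> R) (e : R) :
  preserves_ball T -> half_contraction T -> 0 < e ->
  exists n, forall j, Rabs (iterate T n j - limit_point T j) <= e /\
                      Rabs (iterate T (S n) j - limit_point T j) <= e.
Proof.
  intros HB HC He.
  set (b := fun n => 2 * (/ 2) ^ n).
  assert (Hb : ex_series b).
  { apply ex_series_Rscal, ex_series_geom. rewrite Rabs_right; lra. }
  assert (Hd : forall n j, Rabs (iterate T (S n) j - iterate T n j) <= b n).
  { unfold b. induction n; intros j.
    - change (Rabs (T (iterate T 0) j - 0) <= 2 * (/ 2) ^ 0).
      rewrite Rminus_0_r.
      assert (X := HB _ (in_ball_iterate T 0 HB) j). simpl pow. lra.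
    - replace (2 * (/ 2) ^ S n) with (2 * (/ 2) ^ n / 2) by (simpl; field).
      apply (HC (iterate T (S n)) (iterate T n)); auto using in_ball_iterate. }
  assert (Hs : forall n j, sum_n (fun n => iterate T (S n) j - iterate T n j) n
                = iterate T (S n) j).
  { intros n j. induction n.
    - rewrite sum_O. simpl. ring.
    - rewrite sum_Sn, IHn. unfold plus; simpl. ring. }
  assert (Ht : forall n j, Rabs (iterate T (S n) j - limit_point T j) <= Series b - sum_n b n).
  { intros n j. rewrite <- Hs. apply series_tail; auto. }
  destruct (series_tail_small b e Hb He) as [n Hn].
  exists (S n). intros j. split.
  - eapply Rle_trans; [apply Ht|]. eapply Rle_trans; [apply Rle_abs|]. apply Rlt_le, Hn. lia.
  - eapply Rle_trans; [apply Ht|]. eapply Rle_trans; [apply Rle_abs|]. apply Rlt_le, Hn. lia.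
Qed.

Lemma in_ball_limit_point (T : (nat -> R) -> nat -> R) :
  preserves_ball T -> half_contraction T -> in_ball (limit_point T).
Proof.
  intros HB HC j. apply le_epsilon. intros e He.
  destruct (iterate_limit T e HB HC He) as [n Hn]. destruct (Hn j) as [H1 _].
  assert (X := in_ball_iterate T n HB j). rewrite Rabs_minus_sym in H1.
  assert (Y := Rabs_triang (limit_point T j - iterate T n j) (iterate T n j)).
  replace (limit_point T j - iterate T n j + iterate T n j) with (limit_point T j) in Y by ring.
  lra.
Qed.

Lemma limit_point_fixed (T : (nat -> R) -> nat -> R) (j : nat) :
  preserves_ball T -> half_contraction T -> T (limit_point T) j = limit_point T j.
Proof.
  intros HB HC. apply Rabs_le_eps. intros e He.
  assert (He2 : 0 < e / 2) by lra.
  destruct (iterate_limit T (e / 2) HB HC He2) as [n Hn]. destruct (Hn j) as [_ H2].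
  assert (H3 : Rabs (T (limit_point T) j - T (iterate T n) j) <= e / 2 / 2).
  { apply HC; auto using in_ball_iterate, in_ball_limit_point.
    intros i. rewrite Rabs_minus_sym. apply Hn. }
  change (iterate T (S n) j) with (T (iterate T n) j) in H2.
  assert (Y := Rabs_triang (T (limit_point T) j - T (iterate T n) j)
                 (T (iterate T n) j - limit_point T j)).
  replace (T (limit_point T) j - T (iterate T n) j + (T (iterate T n) j - limit_point T j))
    with (T (limit_point T) j - limit_point T j) in Y by ring.
  lra.
Qed.

(** The value 2d is the fixed point of r -> r/2 + d; the distance starts from the diameter 2 of the
    ball and is improved by iterating this map. *)
Lemma limit_point_lipschitz (T T' : (nat -> R) -> nat -> R) (d : R) :
  preserves_ball T -> half_contraction T -> preserves_ball T' -> half_contraction T' ->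
  (forall u, in_ball u -> forall j, Rabs (T u j - T' u j) <= d) ->
  forall j, Rabs (limit_point T j - limit_point T' j) <= 2 * d.
Proof.
  intros HB HC HB' HC' Hd.
  set (u := limit_point T). set (u' := limit_point T').
  assert (Bu : in_ball u) by now apply in_ball_limit_point.
  assert (Bu' : in_ball u') by now apply in_ball_limit_point.
  assert (K : forall n j, Rabs (u j - u' j) <= 2 * (/ 2) ^ n + 2 * d).
  { induction n; intros j.
    - assert (X := Bu j). assert (Y := Bu' j).
      assert (Z := Rabs_triang (u j) (- u' j)). rewrite Rabs_Ropp in Z.
      assert (W := Hd u Bu 0%nat). assert (V := Rabs_pos (T u 0%nat - T' u 0%nat)).
      simpl pow. unfold Rminus at 1. lra.
    - unfold u at 1, u' at 1.
      rewrite <- (limit_point_fixed T j), <- (limit_point_fixed T' j) by auto.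
      fold u u'.
      replace (T u j - T' u' j) with ((T u j - T u' j) + (T u' j - T' u' j)) by ring.
      eapply Rle_trans; [apply Rabs_triang|].
      assert (X := HC u u' _ Bu Bu' IHn j). assert (Y := Hd u' Bu' j).
      simpl pow. lra. }
  intros j. apply le_epsilon. intros e He.
  assert (Ha : Rabs (/ 2) < 1) by (rewrite Rabs_right; lra).
  destruct (pow_lt_1_zero (/ 2) Ha (e / 2)) as [n Hn]. { lra. }
  specialize (Hn n (Nat.le_refl n)). specialize (K n j).
  assert (X := Rle_abs ((/ 2) ^ n)). lra.
Qed.

(** The mean value bound n t^(n-1) |x - y|, multiplied by [t] to avoid the exponent n - 1. *)
Lemma pow_diff_le (t x y : R) (n : nat) : 0 <= t -> Rabs x <= t -> Rabs y <= t ->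
  t * Rabs (x ^ n - y ^ n) <= INR n * t ^ n * Rabs (x - y).
Proof.
  intros Ht Hx Hy. induction n.
  - simpl. rewrite Rminus_diag, Rabs_R0. lra.
  - rewrite S_INR. simpl pow.
    replace (x * x ^ n - y * y ^ n) with (x * (x ^ n - y ^ n) + (x - y) * y ^ n) by ring.
    assert (A := Rabs_triang (x * (x ^ n - y ^ n)) ((x - y) * y ^ n)).
    rewrite !Rabs_mult in A.
    assert (B : Rabs (y ^ n) <= t ^ n).
    { rewrite <- RPow_abs. apply pow_incr. split; auto using Rabs_pos. }
    assert (P := Rabs_pos (x - y)). assert (Q := Rabs_pos (x ^ n - y ^ n)).
    assert (U : Rabs x * Rabs (x ^ n - y ^ n) <= t * Rabs (x ^ n - y ^ n))
      by now apply Rmult_le_compat_r.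
    assert (V : Rabs (x - y) * Rabs (y ^ n) <= Rabs (x - y) * t ^ n)
      by now apply Rmult_le_compat_l.
    apply Rle_trans with (t * (INR n * t ^ n * Rabs (x - y) + Rabs (x - y) * t ^ n)).
    + apply Rmult_le_compat_l; auto. lra.
    + right. ring.
Qed.

(** * The quadratic interaction of the modes *)

Definition coupling (w g : R) (j l : nat) : R :=
  w ^ 2 + (g * w ^ 3 * INR l ^ 2 - w) / (INR j + INR l).

(** The quadratic side of the [j]-th equation divided by [eta ^ 2 * s ^ j]. In [coupling], the term
    [w ^ 2] comes from [H[(Λf)^2]], the term [- w] from [[H,f] Λf] and the cubic one from [[H,f] Λ^3
    f]; the denominator is the index of the high mode [a_(j+l)]. The convolution is the rest of
    [H[(Λf)^2]]. *)
Definition interaction (w g s : R) (b : nat -> R) (j : nat) : R :=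
  / 2 * w ^ 2 * convolution b b j
  + Series (fun l => coupling w g j l * ((s ^ 2) ^ l * (b (j + l)%nat * b l))).

(* Dominates both [(s^2)^l] and its Lipschitz constant in s for |s| <= 1/2. *)
Definition tail_weight (l : nat) : R := (1 + 4 * INR l) * (/ 4) ^ l.

Definition coupling_bound (w g : R) (l : nat) : R :=
  (Rabs (g * w ^ 3) * INR l ^ 2 + (w ^ 2 + Rabs w)) * tail_weight l.

(** The [+ 1] keeps the constant away from 0, since [eta] is later obtained by dividing by it. *)
Definition interaction_bound (w g : R) : R :=
  / 2 * w ^ 2 + Series (coupling_bound w g) + 1.

(** The bound is uniform in [j]: the derivatives act on the low mode [l], and [j >= 1] keeps the
    denominator at least 1. *)
Lemma coupling_le (w g : R) (j l : nat) : (1 <= j)%nat ->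
  Rabs (coupling w g j l) <= Rabs (g * w ^ 3) * INR l ^ 2 + (w ^ 2 + Rabs w).
Proof.
  intros Hj. unfold coupling. apply le_INR in Hj. simpl in Hj. assert (X := pos_INR l).
  eapply Rle_trans; [apply Rabs_triang|].
  rewrite (Rabs_right (w ^ 2)) by (apply Rle_ge, pow2_ge_0).
  assert (Rabs ((g * w ^ 3 * INR l ^ 2 - w) / (INR j + INR l))
     <= Rabs (g * w ^ 3) * INR l ^ 2 + Rabs w); [|lra].
  unfold Rdiv. rewrite Rabs_mult, Rabs_inv, (Rabs_right (INR j + INR l)) by lra.
  assert (Y := Rabs_triang (g * w ^ 3 * INR l ^ 2) (- w)).
  rewrite Rabs_Ropp, Rabs_mult, (Rabs_right (INR l ^ 2)) in Y by (apply Rle_ge, pow2_ge_0).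
  fold (g * w ^ 3 * INR l ^ 2 - w) in Y.
  assert (Z := Rabs_pos (g * w ^ 3 * INR l ^ 2 - w)).
  assert (V : / (INR j + INR l) <= 1).
  { rewrite <- Rinv_1. apply Rinv_le_contravar; lra. }
  apply Rle_trans with (Rabs (g * w ^ 3 * INR l ^ 2 - w) * 1); [|lra].
  now apply Rmult_le_compat_l.
Qed.

Lemma tail_weight_pos (l : nat) : 0 <= tail_weight l.
Proof.
  unfold tail_weight. assert (X := pos_INR l).
  apply Rmult_le_pos; [lra | apply pow_le; lra].
Qed.

Lemma tail_weight_ge (l : nat) : (/ 4) ^ l <= tail_weight l.
Proof.
  unfold tail_weight. assert (X := pos_INR l).
  assert (P : 0 <= (/ 4) ^ l) by (apply pow_le; lra).
  assert (Q : 0 <= INR l * (/ 4) ^ l) by now apply Rmult_le_pos. lra.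
Qed.

Lemma decays_geom (q : R) : 0 <= q < 1 -> decays (fun l => q ^ l).
Proof.
  intros H. exists 1, q. split; auto. intros k.
  rewrite Rabs_right; [lra | apply Rle_ge, pow_le; lra].
Qed.

Lemma ex_coupling_bound (w g : R) : ex_series (coupling_bound w g).
Proof.
  assert (D0 : decays (fun l => (/ 4) ^ l)) by (apply decays_geom; lra).
  assert (D1 := decays_INR _ D0). assert (D2 := decays_INR _ D1). assert (D3 := decays_INR _ D2).
  set (p := w ^ 2 + Rabs w). set (q := Rabs (g * w ^ 3)).
  apply ex_series_Rext with (fun l =>
    p * (/ 4) ^ l + 4 * p * (INR l * (/ 4) ^ l) + q * (INR l * (INR l * (/ 4) ^ l))
    + 4 * q * (INR l * (INR l * (INR l * (/ 4) ^ l)))).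
  - intros l. unfold coupling_bound, tail_weight. fold p q. ring.
  - repeat apply ex_series_Rplus; apply ex_series_Rscal; now apply decays_ex_series.
Qed.

Lemma coupling_bound_pos (w g : R) : 0 <= Series (coupling_bound w g).
Proof.
  eapply Rle_trans; [apply Rabs_pos|]. apply (Rabs_Series_le (fun _ => 0)).
  - intros l. rewrite Rabs_R0. unfold coupling_bound. apply Rmult_le_pos.
    + assert (X := Rabs_pos (g * w ^ 3)). assert (Y := pow2_ge_0 (INR l)).
      assert (Z := pow2_ge_0 w). assert (V := Rabs_pos w).
      assert (U := Rmult_le_pos _ _ X Y). lra.
    + apply tail_weight_pos.
  - apply ex_coupling_bound.
Qed.

Lemma interaction_bound_ge (w g : R) : 1 <= interaction_bound w g.
Proof.
  unfold interaction_bound. assert (X := coupling_bound_pos w g).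
  assert (Y := pow2_ge_0 w). lra.
Qed.

Lemma coupling_series_le (w g d : R) (j : nat) (S : nat -> R) : (1 <= j)%nat ->
  (forall l, Rabs (S l) <= d * tail_weight l) ->
  ex_series (fun l => coupling w g j l * S l) /\
  Rabs (Series (fun l => coupling w g j l * S l)) <= d * Series (coupling_bound w g).
Proof.
  intros Hj HS.
  assert (H : forall l, Rabs (coupling w g j l * S l) <= d * coupling_bound w g l).
  { intros l. rewrite Rabs_mult. unfold coupling_bound.
    replace (d * ((Rabs (g * w ^ 3) * INR l ^ 2 + (w ^ 2 + Rabs w)) * tail_weight l))
      with ((Rabs (g * w ^ 3) * INR l ^ 2 + (w ^ 2 + Rabs w)) * (d * tail_weight l)) by ring.
    apply Rmult_le_compat; auto using Rabs_pos, coupling_le. }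
  assert (E := ex_series_Rscal d _ (ex_coupling_bound w g)).
  split.
  - now apply ex_series_dom with (fun l => d * coupling_bound w g l).
  - rewrite <- (Series_scal_l d (coupling_bound w g)). now apply Rabs_Series_le.
Qed.

Lemma sum_f_R0_le_const (f : nat -> R) (d : R) (n : nat) :
  (forall k, (k <= n)%nat -> Rabs (f k) <= d) -> Rabs (sum_f_R0 f n) <= d * (INR n + 1).
Proof.
  intros H. eapply Rle_trans; [apply Rsum_abs|].
  eapply Rle_trans; [apply (sum_Rle _ (fun _ => d)); auto|].
  rewrite sum_cte, S_INR. lra.
Qed.

(** For [j >= 1] the factor [2 * INR j] absorbs the [j + 1] terms of the convolution as well as the
    bounded series. *)
Lemma interaction_le_aux (w g d x : R) (j : nat) : (1 <= j)%nat -> 0 <= d ->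
  x <= / 2 * w ^ 2 * (d * (INR j + 1)) + d * Series (coupling_bound w g) ->
  x <= d * interaction_bound w g * (2 * INR j).
Proof.
  intros Hj Hd Hx. apply le_INR in Hj. simpl in Hj.
  assert (P := coupling_bound_pos w g).
  unfold interaction_bound. assert (Z := pow2_ge_0 w).
  set (S := Series (coupling_bound w g)) in *.
  apply Rle_trans with (d * (/ 2 * w ^ 2 * (INR j + 1) + S)); [lra|].
  rewrite (Rmult_assoc d). apply Rmult_le_compat_l; auto.
  assert (S <= S * (2 * INR j)).
  { rewrite <- (Rmult_1_r S) at 1. apply Rmult_le_compat_l; lra. }
  assert (w ^ 2 * (INR j + 1) <= w ^ 2 * (2 * INR j)) by (apply Rmult_le_compat_l; lra).
  lra.
Qed.

Lemma sqr_quarter (s : R) : Rabs s <= / 2 -> Rabs (s ^ 2) <= / 4.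
Proof.
  intros H. rewrite <- RPow_abs. replace (/ 4) with ((/ 2) ^ 2) by field.
  apply pow_incr. split; auto using Rabs_pos.
Qed.

Lemma in_ball_mul (u : nat -> R) (i j : nat) : in_ball u -> Rabs (u i * u j) <= 1.
Proof.
  intros H. rewrite Rabs_mult, <- (Rmult_1_r 1).
  apply Rmult_le_compat; auto using Rabs_pos.
Qed.

Lemma Rabs_mul_diff_le (x y x' y' r : R) : Rabs x <= 1 -> Rabs y' <= 1 ->
  Rabs (x - x') <= r -> Rabs (y - y') <= r -> Rabs (x * y - x' * y') <= 2 * r.
Proof.
  intros Hx Hy H1 H2.
  replace (x * y - x' * y') with (x * (y - y') + (x - x') * y') by ring.
  eapply Rle_trans; [apply Rabs_triang|]. rewrite !Rabs_mult.
  assert (P1 := Rabs_pos (x - x')). assert (P2 := Rabs_pos (y - y')).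
  assert (Rabs x * Rabs (y - y') <= 1 * Rabs (y - y')) by now apply Rmult_le_compat_r.
  assert (Rabs (x - x') * Rabs y' <= Rabs (x - x') * 1) by now apply Rmult_le_compat_l.
  lra.
Qed.

Lemma pow_quarter_le (s : R) (l : nat) : Rabs s <= / 2 -> Rabs ((s ^ 2) ^ l) <= (/ 4) ^ l.
Proof.
  intros H. rewrite <- (RPow_abs (s ^ 2)). apply pow_incr.
  split; [apply Rabs_pos | now apply sqr_quarter].
Qed.

Lemma interaction_terms_le (s : R) (b : nat -> R) (j l : nat) : Rabs s <= / 2 -> in_ball b ->
  Rabs ((s ^ 2) ^ l * (b (j + l)%nat * b l)) <= 1 * tail_weight l.
Proof.
  intros Hs Hb. rewrite Rabs_mult.
  apply Rle_trans with ((/ 4) ^ l * 1).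
  - apply Rmult_le_compat; auto using Rabs_pos, pow_quarter_le, in_ball_mul.
  - assert (X := tail_weight_ge l). lra.
Qed.

Lemma interaction_le (w g s : R) (b : nat -> R) (j : nat) : (1 <= j)%nat ->
  Rabs s <= / 2 -> in_ball b ->
  Rabs (interaction w g s b j) <= interaction_bound w g * (2 * INR j).
Proof.
  intros Hj Hs Hb.
  rewrite <- (Rmult_1_l (interaction_bound w g)).
  apply interaction_le_aux; auto. lra.
  unfold interaction. eapply Rle_trans; [apply Rabs_triang|].
  assert (X := pow2_ge_0 w).
  apply Rplus_le_compat.
  - rewrite Rabs_mult, (Rabs_right (/ 2 * w ^ 2)) by lra.
    apply Rmult_le_compat_l; [lra|].
    apply sum_f_R0_le_const. intros k _. now apply in_ball_mul.
  - apply coupling_series_le; auto. intros l. now apply interaction_terms_le.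
Qed.

(** One estimate serves both Lipschitz bounds: [d] is [2 * r] when the sequence varies and
    [Rabs (s - s')] when the parameter does. *)
Lemma interaction_diff_le (w g d s s' : R) (b b' : nat -> R) (j : nat) : (1 <= j)%nat ->
  0 <= d -> Rabs s <= / 2 -> Rabs s' <= / 2 -> in_ball b -> in_ball b' ->
  (forall i k, Rabs (b i * b k - b' i * b' k) <= d) ->
  (forall l, Rabs ((s ^ 2) ^ l * (b (j + l)%nat * b l) - (s' ^ 2) ^ l * (b' (j + l)%nat * b' l))
       <= d * tail_weight l) ->
  Rabs (interaction w g s b j - interaction w g s' b' j)
    <= d * interaction_bound w g * (2 * INR j).
Proof.
  intros Hj Hd Hs Hs' Hb Hb' H1 H2.
  apply interaction_le_aux; auto.
  unfold interaction.
  destruct (coupling_series_le w g 1 j _ Hj (fun l => interaction_terms_le s b j l Hs Hb)) as [E1 _].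
  destruct (coupling_series_le w g 1 j _ Hj (fun l => interaction_terms_le s' b' j l Hs' Hb')) as [E2 _].
  destruct (coupling_series_le w g d j _ Hj H2) as [_ B].
  match goal with |- Rabs (?p + ?q - (?p' + ?q')) <= _ =>
    replace (p + q - (p' + q')) with ((p - p') + (q - q')) by ring end.
  eapply Rle_trans; [apply Rabs_triang|].
  assert (X := pow2_ge_0 w).
  apply Rplus_le_compat.
  - unfold convolution. rewrite <- Rmult_minus_distr_l, <- minus_sum.
    rewrite Rabs_mult, (Rabs_right (/ 2 * w ^ 2)) by lra.
    apply Rmult_le_compat_l; [lra|].
    apply sum_f_R0_le_const. intros k _. apply H1.
  - rewrite <- Series_minus by auto.
    erewrite Series_ext; [exact B|]. intros l. simpl. ring.
Qed.

Lemma interaction_lipschitz (w g s r : R) (b b' : nat -> R) (j : nat) : (1 <= j)%nat ->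
  Rabs s <= / 2 -> in_ball b -> in_ball b' -> (forall i, Rabs (b i - b' i) <= r) ->
  Rabs (interaction w g s b j - interaction w g s b' j)
    <= 2 * r * interaction_bound w g * (2 * INR j).
Proof.
  intros Hj Hs Hb Hb' H.
  assert (Hr : 0 <= r) by (eapply Rle_trans; [apply Rabs_pos | apply (H 0%nat)]).
  assert (HD : forall i k, Rabs (b i * b k - b' i * b' k) <= 2 * r).
  { intros i k. now apply Rabs_mul_diff_le. }
  apply interaction_diff_le; auto.
  - lra.
  - intros l. rewrite <- Rmult_minus_distr_l, Rabs_mult, Rmult_comm.
    apply Rmult_le_compat; auto using Rabs_pos.
    eapply Rle_trans; [now apply pow_quarter_le | apply tail_weight_ge].
Qed.

Lemma interaction_lipschitz_parameter (w g s s' : R) (b : nat -> R) (j : nat) : (1 <= j)%nat ->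
  Rabs s <= / 2 -> Rabs s' <= / 2 -> in_ball b ->
  Rabs (interaction w g s b j - interaction w g s' b j)
    <= Rabs (s - s') * interaction_bound w g * (2 * INR j).
Proof.
  intros Hj Hs Hs' Hb. assert (P := Rabs_pos (s - s')).
  apply interaction_diff_le; auto.
  - intros i k. rewrite Rminus_diag, Rabs_R0. auto.
  - intros l. rewrite <- Rmult_minus_distr_r, Rabs_mult.
    apply Rle_trans with (Rabs (s - s') * tail_weight l * 1); [|lra].
    apply Rmult_le_compat; auto using Rabs_pos, in_ball_mul.
    assert (X := pow_diff_le (/ 4) (s ^ 2) (s' ^ 2) l ltac:(lra)
                   (sqr_quarter s Hs) (sqr_quarter s' Hs')).
    assert (Y : Rabs (s ^ 2 - s' ^ 2) <= Rabs (s - s')).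
    { replace (s ^ 2 - s' ^ 2) with ((s - s') * (s + s')) by ring. rewrite Rabs_mult.
      assert (Z := Rabs_triang s s').
      rewrite <- (Rmult_1_r (Rabs (s - s'))) at 2. apply Rmult_le_compat_l; lra. }
    assert (Q : 0 <= (/ 4) ^ l) by (apply pow_le; lra).
    assert (U := pos_INR l).
    assert (V : 0 <= INR l * (/ 4) ^ l) by now apply Rmult_le_pos.
    apply (Rmult_le_compat_l _ _ _ V) in Y.
    assert (W : 0 <= Rabs (s - s') * (/ 4) ^ l) by now apply Rmult_le_pos.
    unfold tail_weight. lra.
Qed.

(** * The branch of coefficients *)

(* Slot 0 of the unknown [z] carries the speed correction, so the amplitude
   sequence it encodes has its coefficients 0 and 1 prescribed. *)
Definition amplitudes (z : nat -> R) (j : nat) : R :=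
  match j with O => 0 | 1%nat => 1 | _ => z j end.

(** The speed correction is [rho * z 0]. At j = 1 the symbol vanishes and the amplitude is 1, so
    that equation is solved for the speed and fills slot 0. For j >= 2 the equation is solved for
    [lam j * z j], the speed shift being kept on the right. *)
Definition bifurcation_map (w g : R) (lam e : nat -> R) (rho eta s : R) (z : nat -> R) (j : nat) : R :=
  match j with
  | O => eta * interaction w g s (amplitudes z) 1 / (rho * e 1%nat)
  | 1%nat => 0
  | _ => eta * INR j * interaction w g s (amplitudes z) j / lam j
         - rho * e j * (z 0%nat * z j) / lam j
  end.

(** A product of two unknowns in the unit ball has Lipschitz constant 2. The factors 8 and 16 then
    leave r/2 in slot 0, and r/4 + r/4 from the interaction and the speed shift in the slots j >=
    2. *)
Record small_parameters (M : R) (lam e : nat -> R) (rho eta : R) : Prop := {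
  sp_rho : 0 < rho;
  sp_eta : 0 < eta;
  sp_e1 : 0 < e 1%nat;
  sp_start : 8 * (eta * M) <= rho * e 1%nat;
  sp_lam : forall j, (2 <= j)%nat -> lam j <> 0;
  sp_quad : forall j, (2 <= j)%nat -> 16 * (eta * M) * INR j ^ 2 <= Rabs (lam j);
  sp_shift : forall j, (2 <= j)%nat -> 0 <= e j /\ 8 * rho * e j <= Rabs (lam j) }.

Lemma Rabs_div_le (x y r : R) : y <> 0 -> Rabs x <= r * Rabs y -> Rabs (x / y) <= r.
Proof.
  intros Hy H. unfold Rdiv. rewrite Rabs_mult, Rabs_inv.
  apply Rmult_le_reg_r with (Rabs y). now apply Rabs_pos_lt.
  rewrite Rmult_assoc, Rinv_l, Rmult_1_r; auto. now apply Rabs_no_R0.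
Qed.

Lemma in_ball_amplitudes (z : nat -> R) : in_ball z -> in_ball (amplitudes z).
Proof.
  intros H [|[|j]]; simpl; auto.
  - rewrite Rabs_R0. lra.
  - rewrite Rabs_R1. lra.
Qed.

Lemma amplitudes_diff_le (z z' : nat -> R) (r : R) :
  (forall j, Rabs (z j - z' j) <= r) ->
  forall j, Rabs (amplitudes z j - amplitudes z' j) <= r.
Proof.
  intros H.
  assert (Hr : 0 <= r) by (eapply Rle_trans; [apply Rabs_pos | apply (H 0%nat)]).
  intros [|[|j]]; simpl; auto; now rewrite Rminus_diag, Rabs_R0.
Qed.

(** Here and in [quad_le], [d] stands for 1 in the invariance of the ball, for [2 * r] in the
    contraction, and for [Rabs (s - s')] in the dependence on the parameter. *)
Lemma start_le (M : R) (lam e : nat -> R) (rho eta d q : R) :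
  small_parameters M lam e rho eta ->
  0 <= d -> Rabs q <= d * M * (2 * INR 1) -> Rabs (eta * q / (rho * e 1%nat)) <= d / 4.
Proof.
  intros [Hr He He1 Hs _ _ _] Hd Hq.
  assert (P : 0 < rho * e 1%nat) by now apply Rmult_lt_0_compat.
  apply Rabs_div_le. lra. rewrite Rabs_mult, (Rabs_right eta), (Rabs_right (rho * e 1%nat)) by lra.
  simpl in Hq. apply (Rmult_le_compat_l eta) in Hq; [|lra].
  apply (Rmult_le_compat_l d) in Hs; auto. lra.
Qed.

Lemma quad_le (M : R) (lam e : nat -> R) (rho eta d q : R) (j : nat) :
  small_parameters M lam e rho eta -> (2 <= j)%nat ->
  0 <= d -> Rabs q <= d * M * (2 * INR j) -> Rabs (eta * INR j * q / lam j) <= d / 8.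
Proof.
  intros [Hr He He1 _ Hl Hs _] Hj Hd Hq.
  apply Rabs_div_le; auto. specialize (Hs j Hj).
  assert (X := pos_INR j).
  rewrite !Rabs_mult, (Rabs_right eta), (Rabs_right (INR j)) by lra.
  assert (P : 0 <= eta * INR j) by (apply Rmult_le_pos; lra).
  apply (Rmult_le_compat_l _ _ _ P) in Hq.
  apply (Rmult_le_compat_l d) in Hs; auto. lra.
Qed.

Lemma shift_le (M : R) (lam e : nat -> R) (rho eta d p : R) (j : nat) :
  small_parameters M lam e rho eta -> (2 <= j)%nat ->
  Rabs p <= d -> Rabs (rho * e j * p / lam j) <= d / 8.
Proof.
  intros [Hr He He1 _ Hl _ Hs] Hj Hp.
  assert (Hd : 0 <= d) by (eapply Rle_trans; [apply Rabs_pos | apply Hp]).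
  apply Rabs_div_le; auto. destruct (Hs j Hj) as [H1 H2].
  assert (P : 0 <= rho * e j) by (apply Rmult_le_pos; lra).
  rewrite Rabs_mult, (Rabs_right (rho * e j)) by lra.
  apply (Rmult_le_compat_l _ _ _ P) in Hp.
  apply (Rmult_le_compat_l d) in H2; auto. lra.
Qed.

Lemma bifurcation_map_ball (w g : R) (lam e : nat -> R) (rho eta s : R) :
  small_parameters (interaction_bound w g) lam e rho eta -> Rabs s <= / 2 ->
  preserves_ball (bifurcation_map w g lam e rho eta s).
Proof.
  intros Hp Hs z Hz. assert (Ha := in_ball_amplitudes z Hz).
  assert (HQ : forall j, (1 <= j)%nat -> Rabs (interaction w g s (amplitudes z) j)
      <= 1 * interaction_bound w g * (2 * INR j)).
  { intros j Hj. rewrite Rmult_1_l. now apply interaction_le. }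
  intros [|[|j]]; unfold bifurcation_map.
  - assert (X := start_le _ _ _ _ _ 1 _ Hp Rle_0_1 (HQ 1%nat (le_n _))). lra.
  - rewrite Rabs_R0. lra.
  - assert (X := quad_le _ _ _ _ _ 1 _ (S (S j)) Hp ltac:(lia) Rle_0_1 (HQ (S (S j)) ltac:(lia))).
    assert (Y := shift_le _ _ _ _ _ 1 _ (S (S j)) Hp ltac:(lia) (in_ball_mul z 0 (S (S j)) Hz)).
    eapply Rle_trans; [apply Rabs_triang|]. rewrite Rabs_Ropp. lra.
Qed.

Lemma bifurcation_map_contraction (w g : R) (lam e : nat -> R) (rho eta s : R) :
  small_parameters (interaction_bound w g) lam e rho eta -> Rabs s <= / 2 ->
  half_contraction (bifurcation_map w g lam e rho eta s).
Proof.
  intros Hp Hs z z' r Hz Hz' H.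
  assert (Hr : 0 <= r) by (eapply Rle_trans; [apply Rabs_pos | apply (H 0%nat)]).
  assert (Hr2 : 0 <= 2 * r) by lra.
  assert (HQ : forall j, (1 <= j)%nat -> Rabs (interaction w g s (amplitudes z) j
        - interaction w g s (amplitudes z') j) <= 2 * r * interaction_bound w g * (2 * INR j)).
  { intros j Hj. apply interaction_lipschitz; auto using in_ball_amplitudes, amplitudes_diff_le. }
  intros [|[|j]]; unfold bifurcation_map.
  - assert (X := start_le _ _ _ _ _ _ _ Hp Hr2 (HQ 1%nat (le_n _))).
    unfold Rdiv in *. rewrite <- Rmult_minus_distr_r, <- Rmult_minus_distr_l. lra.
  - rewrite Rminus_diag, Rabs_R0. lra.
  - assert (X := quad_le _ _ _ _ _ _ _ (S (S j)) Hp ltac:(lia) Hr2 (HQ (S (S j)) ltac:(lia))).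
    assert (Y := shift_le _ _ _ _ _ _ _ (S (S j)) Hp ltac:(lia)
      (Rabs_mul_diff_le (z 0%nat) (z (S (S j))) _ _ r (Hz _) (Hz' _) (H 0%nat) (H (S (S j))))).
    revert X Y. generalize (interaction w g s (amplitudes z) (S (S j))),
      (interaction w g s (amplitudes z') (S (S j))), (INR (S (S j))).
    intros q q' n X Y.
    match goal with |- Rabs ?u <= _ => replace u with
      (eta * n * (q - q') / lam (S (S j))
       + - (rho * e (S (S j)) * (z 0%nat * z (S (S j)) - z' 0%nat * z' (S (S j))) / lam (S (S j))))
      by (unfold Rdiv; ring) end.
    eapply Rle_trans; [apply Rabs_triang|]. rewrite Rabs_Ropp. lra.
Qed.

(** The speed shift does not involve [s] and cancels; only the interaction contributes. *)
Lemma bifurcation_map_lipschitz (w g : R) (lam e : nat -> R) (rho eta s s' : R) (z : nat -> R) (j : nat) :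
  small_parameters (interaction_bound w g) lam e rho eta -> Rabs s <= / 2 -> Rabs s' <= / 2 ->
  in_ball z ->
  Rabs (bifurcation_map w g lam e rho eta s z j - bifurcation_map w g lam e rho eta s' z j)
    <= Rabs (s - s') / 4.
Proof.
  intros Hp Hs Hs' Hz. assert (P := Rabs_pos (s - s')).
  assert (HQ : forall j, (1 <= j)%nat -> Rabs (interaction w g s (amplitudes z) j
      - interaction w g s' (amplitudes z) j) <= Rabs (s - s') * interaction_bound w g * (2 * INR j)).
  { intros i Hi. apply interaction_lipschitz_parameter; auto using in_ball_amplitudes. }
  destruct j as [|[|j]]; unfold bifurcation_map.
  - assert (X := start_le _ _ _ _ _ _ _ Hp P (HQ 1%nat (le_n _))).
    unfold Rdiv in *. rewrite <- Rmult_minus_distr_r, <- Rmult_minus_distr_l. lra.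
  - rewrite Rminus_diag, Rabs_R0. lra.
  - assert (X := quad_le _ _ _ _ _ _ _ (S (S j)) Hp ltac:(lia) P (HQ (S (S j)) ltac:(lia))).
    revert X. generalize (interaction w g s (amplitudes z) (S (S j))),
      (interaction w g s' (amplitudes z) (S (S j))), (INR (S (S j))).
    intros q q' n X.
    match goal with |- Rabs ?u <= _ => replace u with (eta * n * (q - q') / lam (S (S j)))
      by (unfold Rdiv; ring) end. lra.
Qed.

Lemma coefficient_branch (w g : R) (lam e : nat -> R) (rho eta : R) :
  small_parameters (interaction_bound w g) lam e rho eta -> lam 1%nat = 0 ->
  exists (d : R -> R) (b : R -> nat -> R),
    (forall s, Rabs s <= / 2 ->
       b s 0%nat = 0 /\ b s 1%nat = 1 /\ in_ball (b s) /\
       forall j, (1 <= j)%nat ->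
         (lam j + d s * e j) * b s j = eta * INR j * interaction w g s (b s) j) /\
    (forall s s', Rabs s <= / 2 -> Rabs s' <= / 2 ->
       Rabs (d s - d s') <= rho * Rabs (s - s') /\
       forall j, Rabs (b s j - b s' j) <= Rabs (s - s')).
Proof.
  intros Hp H1.
  set (T := bifurcation_map w g lam e rho eta).
  set (z := fun s => limit_point (T s)).
  assert (HB : forall s, Rabs s <= / 2 -> preserves_ball (T s))
    by (intros; now apply bifurcation_map_ball).
  assert (HC : forall s, Rabs s <= / 2 -> half_contraction (T s))
    by (intros; now apply bifurcation_map_contraction).
  exists (fun s => rho * z s 0%nat), (fun s => amplitudes (z s)).
  split.
  - intros s Hs. split; [reflexivity|]. split; [reflexivity|].
    assert (Bz : in_ball (z s)) by (apply in_ball_limit_point; auto).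
    split; [now apply in_ball_amplitudes|].
    assert (Fz : forall j, T s (z s) j = z s j) by (intros; apply limit_point_fixed; auto).
    destruct Hp as [Hr He He1 _ Hl _ _].
    intros [|[|j]] Hj; [lia| |].
    (* With [lam 1 = 0] and first amplitude 1, the equation at j = 1 is the fixed point equation of
       slot 0. *)
    + rewrite H1, <- (Fz 0%nat). unfold T, bifurcation_map. simpl amplitudes. simpl INR.
      field. lra.
    + assert (X := Fz (S (S j))). unfold T, bifurcation_map in X.
      assert (L := Hl (S (S j)) ltac:(lia)). simpl amplitudes at 1.
      apply (f_equal (fun x => x * lam (S (S j)))) in X.
      rewrite Rmult_minus_distr_r in X. unfold Rdiv in X. rewrite !Rmult_assoc in X.
      rewrite !Rinv_l in X by auto. lra.
  - intros s s' Hs Hs'.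
    assert (L : forall j, Rabs (z s j - z s' j) <= 2 * (Rabs (s - s') / 4)).
    { apply limit_point_lipschitz; auto. intros u Hu j. now apply bifurcation_map_lipschitz. }
    assert (P := Rabs_pos (s - s')).
    assert (L' : forall j, Rabs (z s j - z s' j) <= Rabs (s - s')).
    { intros j. specialize (L j). lra. }
    split.
    + rewrite <- Rmult_minus_distr_l, Rabs_mult, Rabs_right.
      * apply Rmult_le_compat_l; auto. apply Rlt_le, (sp_rho _ _ _ _ _ Hp).
      * apply Rle_ge, Rlt_le, (sp_rho _ _ _ _ _ Hp).
    + now apply amplitudes_diff_le.
Qed.

(** * Dispersion relation and conclusion *)

(** Multiplier of [2 f_t + alpha0 Λ f_t] at the frequency [j * w], with the speed factored out;
    [restoring] is the opposite of the linear bracket on the right. *)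
Definition inertia (alpha0 w : R) (j : nat) : R :=
  2 * (INR j * w) + alpha0 * (INR j * w) ^ 2.

Definition restoring (g w : R) (j : nat) : R :=
  INR j * w - 1 + g * (INR j * w) ^ 2.

Definition linear_speed (eps alpha0 g w : R) : R :=
  - (1 / eps * restoring g w 1) / inertia alpha0 w 1.

Definition linear_symbol (eps alpha0 g w : R) (j : nat) : R :=
  linear_speed eps alpha0 g w * inertia alpha0 w j + 1 / eps * restoring g w j.

Lemma inertia_pos (alpha0 w : R) (j : nat) :
  0 < alpha0 -> 0 < w -> (1 <= j)%nat -> 0 < inertia alpha0 w j.
Proof.
  intros Ha Hw Hj. apply le_INR in Hj. simpl in Hj. unfold inertia.
  assert (P : 0 < INR j * w) by (apply Rmult_lt_0_compat; lra).
  assert (Q : 0 < alpha0 * (INR j * w) ^ 2) by (apply Rmult_lt_0_compat; auto; now apply pow_lt).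
  lra.
Qed.

Lemma inertia_le (alpha0 w : R) (j : nat) :
  0 < alpha0 -> 0 < w -> inertia alpha0 w j <= inertia alpha0 w 1 * INR j ^ 2.
Proof.
  intros Ha Hw. unfold inertia. simpl (INR 1).
  assert (INR j * w <= INR j ^ 2 * w).
  { apply Rmult_le_compat_r; [lra|]. destruct j as [|j].
    - simpl. lra.
    - assert (X := pos_INR j). rewrite S_INR. nra. }
  lra.
Qed.

(* The symbol vanishes at j = 1 by the choice of the speed, which lets one factor out j - 1. *)
Lemma linear_symbol_factor (eps alpha0 g w : R) (j : nat) :
  0 < eps -> 0 < alpha0 -> 0 < w ->
  linear_symbol eps alpha0 g w j =
  (INR j - 1) * w * (2 + (2 * g - alpha0) * INR j * w ^ 2 + alpha0 * (INR j + 1) * w)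
  / (eps * inertia alpha0 w 1).
Proof.
  intros He Ha Hw. assert (P := inertia_pos alpha0 w 1 Ha Hw (le_n _)).
  unfold linear_symbol, linear_speed, restoring, inertia in *. simpl INR in *.
  field. split; lra.
Qed.

(* A resonance forces 2 + (2g - alpha0) j w^2 + alpha0 (j+1) w = 0, so there is
   none when 2g >= alpha0, nor when w is large. *)
Lemma nonresonance (alpha0 g : R) (m : nat) : 0 < alpha0 -> (1 <= m)%nat ->
  exists p : nat, (1 <= p)%nat /\ exists q, 0 < q /\ forall j, (2 <= j)%nat ->
    let w := INR (m * p) in
    q * INR j * w <= Rabs (2 + (2 * g - alpha0) * INR j * w ^ 2 + alpha0 * (INR j + 1) * w).
Proof.
  intros Ha Hm. set (dl := 2 * g - alpha0).
  assert (Hm' : 1 <= INR m) by (apply le_INR in Hm; simpl in Hm; lra).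
  destruct (Rle_dec 0 dl) as [Hd|Hd].
  - exists 1%nat. split; auto. exists alpha0. split; auto. intros j Hj w.
    assert (Hw : 1 <= w) by (unfold w; rewrite mult_INR; simpl INR; lra).
    assert (X := pos_INR j).
    assert (P : 0 <= dl * INR j * w ^ 2).
    { apply Rmult_le_pos; [now apply Rmult_le_pos | apply pow_le; lra]. }
    assert (Q : 0 < alpha0 * w) by (apply Rmult_lt_0_compat; lra).
    eapply Rle_trans; [|apply Rle_abs]. lra.
  (* Beyond this threshold [- dl * j * w ^ 2] is at least [(3 + 2 alpha0) j w], which exceeds
     [2 + alpha0 (j + 1) w] by at least [j w], because [j + 1 <= 2 j] and [1 <= j w]. *)
  - destruct (archimed ((3 + 2 * alpha0) / - dl)) as [A _].
    set (n := up ((3 + 2 * alpha0) / - dl)) in *.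
    assert (Hq : 0 < (3 + 2 * alpha0) / - dl) by (apply Rdiv_lt_0_compat; lra).
    assert (Hn : (0 < n)%Z) by (apply lt_IZR; lra).
    exists (Z.to_nat n). split. lia. exists 1. split. lra. intros j Hj w.
    assert (Hp : INR (Z.to_nat n) = IZR n) by (rewrite INR_IZR_INZ, Z2Nat.id; auto; lia).
    assert (Hw : (3 + 2 * alpha0) / - dl <= w).
    { unfold w. rewrite mult_INR, Hp. assert (IZR n * 1 <= IZR n * INR m).
      { apply Rmult_le_compat_l; lra. } lra. }
    assert (Hw1 : 1 <= w).
    { unfold w. change 1 with (INR 1). apply le_INR. destruct m; lia. }
    apply le_INR in Hj. simpl in Hj.
    assert (K : 3 + 2 * alpha0 <= - dl * w).
    { apply (Rmult_le_compat_l (- dl)) in Hw; [|lra].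
      replace (- dl * ((3 + 2 * alpha0) / - dl)) with (3 + 2 * alpha0) in Hw by (field; lra).
      exact Hw. }
    assert (P : 1 <= INR j * w) by nra.
    apply (Rmult_le_compat_l (INR j * w)) in K; [|lra].
    assert (Q : alpha0 * w * 1 <= alpha0 * w * INR j).
    { apply Rmult_le_compat_l; [|lra]. apply Rmult_le_pos; lra. }
    rewrite <- Rabs_Ropp. eapply Rle_trans; [|apply Rle_abs]. simpl pow. lra.
Qed.

Lemma linear_symbol_lower_bound (eps alpha0 g : R) (m : nat) :
  0 < eps -> 0 < alpha0 -> (1 <= m)%nat ->
  exists p : nat, (1 <= p)%nat /\ exists kap, 0 < kap /\
    forall j, (2 <= j)%nat ->
      kap * INR j ^ 2 <= Rabs (linear_symbol eps alpha0 g (INR (m * p)) j).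
Proof.
  intros He Ha Hm. destruct (nonresonance alpha0 g m Ha Hm) as (p & Hp & q & Hq & H).
  exists p. split; auto.
  assert (Hw : 1 <= INR (m * p)).
  { change 1 with (INR 1). apply le_INR. destruct m; lia. }
  set (w := INR (m * p)) in *.
  assert (P := inertia_pos alpha0 w 1 Ha ltac:(lra) (le_n _)).
  assert (Pe : 0 < eps * inertia alpha0 w 1) by now apply Rmult_lt_0_compat.
  (* The [/ 2] comes from [j - 1 >= j / 2] for [j >= 2]. *)
  exists (q * w ^ 2 / 2 / (eps * inertia alpha0 w 1)). split.
  - apply Rdiv_lt_0_compat; auto. apply Rdiv_lt_0_compat; [|lra].
    apply Rmult_lt_0_compat; auto. apply pow_lt. lra.
  - intros j Hj. rewrite linear_symbol_factor by lra.
    specialize (H j Hj). cbv zeta in H.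
    apply le_INR in Hj. simpl in Hj.
    unfold Rdiv at 3. rewrite Rabs_mult, (Rabs_right (/ _)).
    2:{ apply Rle_ge, Rlt_le, Rinv_0_lt_compat; auto. }
    unfold Rdiv at 1. rewrite Rmult_assoc, (Rmult_comm (/ _)), <- Rmult_assoc.
    apply Rmult_le_compat_r. { apply Rlt_le, Rinv_0_lt_compat; auto. }
    rewrite Rabs_mult, (Rabs_right ((INR j - 1) * w)) by (apply Rle_ge, Rmult_le_pos; lra).
    apply Rle_trans with ((INR j / 2 * w) * (q * INR j * w)).
    + right. field.
    + apply Rmult_le_compat; auto.
      * apply Rmult_le_pos; lra.
      * apply Rmult_le_pos; [apply Rmult_le_pos|]; lra.
      * apply Rmult_le_compat_r; lra.
Qed.

Lemma small_parameters_exist (M eps alpha0 g w kap : R) :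
  0 < eps -> 0 < alpha0 -> 0 < w -> 1 <= M -> 0 < kap ->
  (forall j, (2 <= j)%nat -> kap * INR j ^ 2 <= Rabs (linear_symbol eps alpha0 g w j)) ->
  exists rho eta, small_parameters M (linear_symbol eps alpha0 g w) (inertia alpha0 w) rho eta.
Proof.
  intros He Ha Hw HM Hk H.
  assert (P := inertia_pos alpha0 w 1 Ha Hw (le_n _)).
  (* Since the inertia at [j] is at most [j ^ 2] times the one at 1, this [rho] meets the shift
     condition. Then [8 * eta * M <= rho * e 1 = kap / 8] accounts for the 64. *)
  exists (kap / 8 / inertia alpha0 w 1), (kap / 64 / M).
  assert (EM : kap / 64 / M * M = kap / 64) by (field; lra).
  assert (Er : kap / 8 / inertia alpha0 w 1 * inertia alpha0 w 1 = kap / 8) by (field; lra).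
  split.
  - repeat apply Rdiv_lt_0_compat; lra.
  - repeat apply Rdiv_lt_0_compat; lra.
  - auto.
  - rewrite EM, Er. lra.
  - intros j Hj E. specialize (H j Hj). rewrite E, Rabs_R0 in H.
    assert (0 < kap * INR j ^ 2); [|lra].
    apply Rmult_lt_0_compat; auto. apply pow_lt. apply lt_0_INR. lia.
  - intros j Hj. rewrite EM. eapply Rle_trans; [|now apply H].
    apply Rmult_le_compat_r; [apply pow2_ge_0 | lra].
  - intros j Hj. split.
    + apply Rlt_le, inertia_pos; auto. lia.
    + eapply Rle_trans; [|now apply H].
      assert (X := inertia_le alpha0 w j Ha Hw).
      assert (Y : 0 <= 8 * (kap / 8 / inertia alpha0 w 1)).
      { apply Rmult_le_pos; [lra|]. apply Rlt_le. repeat apply Rdiv_lt_0_compat; lra. }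
      apply (Rmult_le_compat_l _ _ _ Y) in X. eapply Rle_trans; [exact X|].
      right. field. lra.
Qed.

(** * From scaled amplitudes to Fourier coefficients *)

Definition coefficients (eta s : R) (b : nat -> R) (j : nat) : R :=
  eta * s ^ j * b j / INR j.

Lemma coefficients_0 (eta s : R) (b : nat -> R) : b 0%nat = 0 -> coefficients eta s b 0 = 0.
Proof. intros H. unfold coefficients. rewrite H. unfold Rdiv. ring. Qed.

Lemma Rabs_div_INR_le (x : R) (j : nat) : Rabs (x / INR j) <= Rabs x.
Proof.
  unfold Rdiv. rewrite Rabs_mult. rewrite <- (Rmult_1_r (Rabs x)) at 2.
  apply Rmult_le_compat_l; [apply Rabs_pos|].
  destruct j as [|j].
  - simpl. rewrite Rinv_0, Rabs_R0. lra.
  - assert (X := pos_INR j). rewrite Rabs_inv, S_INR, Rabs_right by lra.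
    rewrite <- Rinv_1. apply Rinv_le_contravar; lra.
Qed.

Lemma decays_coefficients (eta s : R) (b : nat -> R) :
  Rabs s <= / 2 -> in_ball b -> decays (coefficients eta s b).
Proof.
  intros Hs Hb. apply decays_le with (fun j => eta * (/ 2) ^ j).
  2:{ apply decays_scal, decays_geom. lra. }
  intros j. eapply Rle_trans; [apply Rabs_div_INR_le|].
  rewrite Rmult_assoc, !Rabs_mult. apply Rmult_le_compat_l; [apply Rabs_pos|].
  rewrite <- (Rmult_1_r (Rabs ((/ 2) ^ j))).
  apply Rmult_le_compat; auto using Rabs_pos.
  rewrite <- !RPow_abs, (Rabs_right (/ 2)) by lra.
  apply pow_incr. split; auto using Rabs_pos.
Qed.

(** The constant 3 is 2 + 1: the powers of [s] give [j (/2)^(j-1) = 2 j (/2)^j], and the amplitudes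
    give [(/2)^j <= j (/2)^j]. *)
Lemma coefficients_diff_le (eta s s' : R) (b b' : nat -> R) (j : nat) : 0 < eta ->
  Rabs s <= / 2 -> Rabs s' <= / 2 -> in_ball b -> b 0%nat = 0 -> b' 0%nat = 0 ->
  (forall i, Rabs (b i - b' i) <= Rabs (s - s')) ->
  Rabs (coefficients eta s b j - coefficients eta s' b' j)
    <= Rabs (s - s') * (3 * eta * (INR j * (/ 2) ^ j)).
Proof.
  intros He Hs Hs' Hb H0 H0' H.
  destruct j as [|j].
  - rewrite !coefficients_0, Rminus_diag, Rabs_R0 by auto. simpl. lra.
  - unfold coefficients.
    replace (eta * s ^ S j * b (S j) / INR (S j) - eta * s' ^ S j * b' (S j) / INR (S j))
      with (eta * ((s ^ S j - s' ^ S j) * b (S j) + s' ^ S j * (b (S j) - b' (S j))) / INR (S j))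
      by (unfold Rdiv; ring).
    eapply Rle_trans; [apply Rabs_div_INR_le|].
    rewrite Rabs_mult, (Rabs_right eta) by lra.
    replace (Rabs (s - s') * (3 * eta * (INR (S j) * (/ 2) ^ S j)))
      with (eta * (Rabs (s - s') * (3 * (INR (S j) * (/ 2) ^ S j)))) by ring.
    apply Rmult_le_compat_l; [lra|].
    eapply Rle_trans; [apply Rabs_triang|]. rewrite !Rabs_mult.
    assert (X := pow_diff_le (/ 2) s s' (S j) ltac:(lra) Hs Hs').
    assert (Y : Rabs (s' ^ S j) <= (/ 2) ^ S j).
    { rewrite <- RPow_abs. apply pow_incr. split; auto using Rabs_pos. }
    assert (N1 : 1 <= INR (S j)) by (change 1 with (INR 1); apply le_INR; lia).
    set (n := INR (S j)) in *. set (h := (/ 2) ^ S j) in *.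
    set (D := Rabs (s - s')) in *.
    assert (PD : 0 <= D) by apply Rabs_pos.
    assert (Ph : 0 <= h) by (apply pow_le; lra).
    assert (U : Rabs (s ^ S j - s' ^ S j) * Rabs (b (S j)) <= Rabs (s ^ S j - s' ^ S j) * 1)
      by (apply Rmult_le_compat_l; [apply Rabs_pos | apply Hb]).
    assert (V : Rabs (s' ^ S j) * Rabs (b (S j) - b' (S j)) <= h * D)
      by (apply Rmult_le_compat; auto using Rabs_pos).
    assert (W : h * D * 1 <= h * D * n) by (apply Rmult_le_compat_l; [now apply Rmult_le_pos | auto]).
    lra.
Qed.

(** The division by [j] in [coefficients] is made for this: one Λ leaves the bare amplitudes. At
    [j = 0] the left side is 0, whence the condition on [b 0]. *)
Lemma freq_coefficients (N : nat) (eta s : R) (b : nat -> R) : b 0%nat = 0 ->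
  freq N (coefficients eta s b) = fun j => INR N * eta * (s ^ j * b j).
Proof.
  intros H0. apply functional_extensionality. intros j. unfold freq, coefficients.
  rewrite mult_INR. destruct j as [|j].
  - rewrite H0. simpl. ring.
  - field. apply not_0_INR. lia.
Qed.

(** The scaled equation is multiplied back by [eta * s ^ j / INR j]. There is no division by [s], so
    the rest state [s = 0] needs no separate treatment. *)
Lemma coefficients_balance (N : nat) (eps alpha0 g d eta s : R) (b : nat -> R) (j : nat) :
  (1 <= j)%nat -> Rabs s <= / 2 -> in_ball b -> b 0%nat = 0 ->
  let w := INR N in
  let a := coefficients eta s b in
  let c := linear_speed eps alpha0 g w + d in
  (linear_symbol eps alpha0 g w j + d * inertia alpha0 w j) * b j
    = eta * INR j * interaction w g s b j ->
  c * (2 * freq N a j + alpha0 * freq N (freq N a) j)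
  + 1 / eps * (freq N a j - a j + g * freq N (freq N a) j)
  = / 2 * convolution (freq N a) (freq N a) j + correlation (freq N a) (freq N a) j
    - correlation a (freq N a) j + g * correlation a (freq N (freq N (freq N a))) j.
Proof.
  intros Hj Hs Hb H0 w a c H.
  assert (Da : decays a) by now apply decays_coefficients.
  assert (D1 := decays_freq N a Da). assert (D3 := decays_freq N _ (decays_freq N _ D1)).
  assert (Hj0 : INR j <> 0) by (apply not_0_INR; lia).
  assert (L : c * (2 * freq N a j + alpha0 * freq N (freq N a) j)
      + 1 / eps * (freq N a j - a j + g * freq N (freq N a) j)
      = eta * s ^ j / INR j * ((linear_symbol eps alpha0 g w j + d * inertia alpha0 w j) * b j)).
  { unfold c, linear_symbol, restoring, inertia, freq. rewrite mult_INR. fold w.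
    replace (a j) with (eta * s ^ j / INR j * b j) by (unfold a, coefficients; field; auto).
    generalize (linear_speed eps alpha0 g w), (1 / eps). intros c0 ie. ring. }
  rewrite L, H. clear L H.
  assert (Cv : convolution (freq N a) (freq N a) j = w ^ 2 * eta ^ 2 * s ^ j * convolution b b j).
  { unfold convolution, a. rewrite freq_coefficients by auto. rewrite scal_sum.
    apply sum_eq. intros k Hk. fold w.
    replace (s ^ j) with (s ^ k * s ^ (j - k)) by (rewrite <- pow_add; f_equal; lia). ring. }
  assert (E : forall u v, decays u -> decays v -> ex_series (fun l => u (j + l)%nat * v l)).
  { intros u v Hu Hv. destruct (correlation_dom u v Hu Hv) as (A & _ & B).
    apply ex_series_dom with (fun l => A j * Rabs (v l)); auto.
    now apply ex_series_Rscal, decays_ex. }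
  assert (E1 := E _ _ D1 D1). assert (E2 := E _ _ Da D1). assert (E3 := E _ _ Da D3).
  (* In the difference modes [s^(j+l) s^l = s^j (s^2)^l], which is the origin of the weight in
     [interaction]. *)
  assert (Cr : eta ^ 2 * s ^ j * Series (fun l => coupling w g j l * ((s ^ 2) ^ l * (b (j + l)%nat * b l)))
    = correlation (freq N a) (freq N a) j - correlation a (freq N a) j
      + g * correlation a (freq N (freq N (freq N a))) j).
  { unfold correlation. rewrite <- Series_minus by auto.
    rewrite <- Series_scal_l, <- (Series_scal_l g), <- Series_plus.
    - apply Series_ext. intros l.
      assert (Hjl : INR j + INR l <> 0) by (rewrite <- plus_INR; apply not_0_INR; lia).
      unfold freq at 4 5. unfold a. rewrite freq_coefficients by auto. rewrite mult_INR. fold w.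
      unfold coefficients, coupling.
      rewrite plus_INR, pow_add, <- pow_mult, (Nat.mul_comm 2 l), pow_mult. field. auto.
    - apply ex_series_Rext with (fun l => freq N a (j + l)%nat * freq N a l
        + -1 * (a (j + l)%nat * freq N a l)).
      + intros l. ring.
      + now apply ex_series_Rplus, ex_series_Rscal.
    - now apply ex_series_Rscal. }
  rewrite Cv. unfold interaction.
  match goal with |- ?L = ?p + ?q - ?r + ?t =>
    replace (p + q - r + t) with (p + (q - r + t)) by ring end.
  rewrite <- Cr. field. auto.
Qed.

(** * First Fourier coefficient, symmetry and the branch of waves *)

Lemma is_RInt_cos_mul_cos (N k : nat) : N <> 0%nat -> k <> 0%nat ->
  is_RInt (fun x => cos (INR (k * N) * (x - 0)) * cos (INR N * x)) 0 PI
    (if Nat.eqb k 1 then PI / 2 else 0).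
Proof.
  intros HN Hk.
  apply is_RInt_ext with (fun x => scal (/ 2) (plus (cos (INR (k * N + N) * x))
                                              (cos (INR (k * N - N) * x)))).
  - intros x _. rewrite plus_INR, minus_INR by nia. rewrite Rminus_0_r.
    rewrite Rmult_plus_distr_r, Rmult_minus_distr_r, cos_plus, cos_minus.
    unfold scal, plus; simpl; unfold mult; simpl.
    generalize (cos (INR (k * N) * x)), (cos (INR N * x)),
      (sin (INR (k * N) * x)), (sin (INR N * x)). intros. field.
  - eapply is_RInt_eq.
    + apply (is_RInt_scal (V := R_NormedModule)), (is_RInt_plus (V := R_NormedModule));
        apply is_RInt_cos.
    + replace (Nat.eqb (k * N + N) 0) with false by (symmetry; apply Nat.eqb_neq; lia).
      unfold scal, plus; simpl; unfold mult; simpl.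
      destruct (Nat.eqb_spec k 1) as [->|Hk1].
      * replace (1 * N - N)%nat with 0%nat by lia. simpl. field.
      * replace (Nat.eqb (k * N - N) 0) with false; [field|].
        symmetry. apply Nat.eqb_neq. nia.
Qed.

(** This recovers the parameter from the profile. Half a period suffices, since distinct cosine
    modes are already orthogonal on [[0, PI]]. *)
Lemma first_fourier_coefficient (N : nat) (a : nat -> R) : N <> 0%nat -> decays a ->
  a 0%nat = 0 ->
  is_RInt (fun x => cos_series N 0 a x * cos (INR N * x)) 0 PI (a 1%nat * (PI / 2)).
Proof.
  intros HN Ha H0.
  set (J := fun k => a k * (if Nat.eqb k 1 then PI / 2 else 0)).
  destruct (is_RInt_Series (fun k x => a k * (cos (INR (k * N) * (x - 0)) * cos (INR N * x)))
     J (fun k => Rabs (a k)) 0 PI) as [E1 E2].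
  - intros k x. rewrite <- Rmult_assoc.
    eapply Rle_trans; [apply Rabs_mul_cos_le | apply Rabs_mul_cos_le].
  - now apply decays_ex.
  - intros [|k].
    + eapply is_RInt_eq.
      * apply is_RInt_ext with (fun _ => 0). { intros x _. rewrite H0. now rewrite Rmult_0_l. }
        apply (is_RInt_const (V := R_NormedModule)).
      * unfold J. rewrite H0. unfold scal; simpl; unfold mult; simpl. ring.
    + apply (is_RInt_scal (V := R_NormedModule)). now apply is_RInt_cos_mul_cos.
  - apply is_RInt_eq with (Series J).
    + revert E2. apply is_RInt_ext. intros x _. unfold cos_series.
      rewrite <- Series_scal_r. apply Series_ext. intros k. ring.
    + rewrite (Series_incr_n J 2) by auto with arith. simpl sum_f_R0.
      rewrite (Series_ext _ (fun _ => 0 * 0)).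
      * rewrite Series_scal_l. unfold J. simpl. ring.
      * intros k. unfold J. simpl. ring.
Qed.

(** A shift by [2 PI / m] advances mode [k] by [k * p] full turns. *)
Lemma m_fold_cos_series (m p : nat) (a : nat -> R) : (1 <= m)%nat ->
  m_fold m (cos_series (m * p) 0 a).
Proof.
  intros Hm x. apply Series_ext. intros k. f_equal.
  replace (INR (k * (m * p)) * (x + 2 * PI / INR m - 0))
    with (INR (k * (m * p)) * (x - 0) + 2 * INR (k * p) * PI).
  - apply cos_period.
  - rewrite !mult_INR. field. apply not_0_INR. lia.
Qed.

Theorem theorem1p1 :
  forall (eps alpha0 beta : R) (m : nat),
    0 < eps -> 0 < alpha0 -> alpha0 <> beta -> (1 <= m)%nat ->
    exists (a b : R) (c : R -> R) (phi : R -> R -> R),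
      curve_of_nontrivial_profiles a b c phi /\
      forall s, a < s < b ->
        m_fold m (phi s) /\
        forall T, 0 < T ->
          classical_solution eps alpha0 beta T (traveling_wave (phi s) (c s)).
Proof.
  intros eps alpha0 beta m He Ha _ Hm.
  destruct (linear_symbol_lower_bound eps alpha0 (alpha0 - beta) m He Ha Hm)
    as (p & Hp & kap & Hk & Hlam).
  set (N := (m * p)%nat) in *. set (w := INR N) in *. set (g := alpha0 - beta) in *.
  assert (HN : N <> 0%nat) by (unfold N; nia).
  assert (Hw : 0 < w) by (apply lt_0_INR; lia).
  (* The order of choices matters: [interaction_bound] depends on [w] and [g] only, so [rho] and
     [eta] can be fixed after the frequency [N] and the gap [kap]. *)
  destruct (small_parameters_exist (interaction_bound w g) eps alpha0 g w kap He Ha Hw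
    (interaction_bound_ge w g) Hk Hlam) as (rho & eta & Hsp).
  assert (Heta := sp_eta _ _ _ _ _ Hsp). assert (Hrho := sp_rho _ _ _ _ _ Hsp).
  destruct (coefficient_branch w g _ _ rho eta Hsp) as (d & b & Hb & Hlip).
  { rewrite linear_symbol_factor by auto. simpl INR. unfold Rdiv. ring. }
  set (a := fun s => coefficients eta s (b s)).
  assert (Hhalf : forall s, - / 2 < s < / 2 -> Rabs s <= / 2) by (intros; apply Rabs_le; lra).
  assert (Da : forall s, - / 2 < s < / 2 -> decays (a s)).
  { intros s Hs. apply decays_coefficients; auto. now apply Hb, Hhalf. }
  assert (a0 : forall s, - / 2 < s < / 2 -> a s 0%nat = 0).
  { intros s Hs. now apply coefficients_0, Hb, Hhalf. }
  assert (a1 : forall s, - / 2 < s < / 2 -> a s 1%nat = eta * s).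
  { intros s Hs. unfold a, coefficients. destruct (Hb s (Hhalf s Hs)) as (_ & -> & _).
    simpl. field. }
  assert (Fc : forall s, - / 2 < s < / 2 ->
    is_RInt (fun x => cos_series N 0 (a s) x * cos (INR N * x)) 0 PI (eta * s * (PI / 2))).
  { intros s Hs. rewrite <- a1 by auto. apply first_fourier_coefficient; auto. }
  assert (PP := PI_RGT_0).
  exists (- / 2), (/ 2), (fun s => linear_speed eps alpha0 g w + d s), (fun s => cos_series N 0 (a s)).
  split; [split; [lra|split; [|split; [|split; [|split]]]]|].
  - intros s Hs. apply C3_cos_series. auto.
  - destruct (Derive_n_cos_series_diff_le N 0 (fun j => 3 * eta * (INR j * (/ 2) ^ j))) as (K & HK & HD).
    { apply decays_scal, decays_INR, decays_geom. lra. }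
    intros s0 Hs0 e Hepos.
    assert (Hden : 0 < rho + K + 1) by lra.
    (* [rho] bounds the variation of the speed and [K] that of the profile; the [+ 1] ensures a
       positive denominator. *)
    exists (e / (rho + K + 1)). split. { now apply Rdiv_lt_0_compat. }
    intros s Hs Hss.
    apply (Rmult_lt_compat_r _ _ _ Hden) in Hss.
    replace (e / (rho + K + 1) * (rho + K + 1)) with e in Hss by (field; lra).
    assert (P := Rabs_pos (s - s0)).
    destruct (Hlip s s0 (Hhalf s Hs) (Hhalf s0 Hs0)) as [L1 L2].
    assert (Q1 : 0 <= Rabs (s - s0) * rho) by (apply Rmult_le_pos; lra).
    assert (Q2 : 0 <= Rabs (s - s0) * K) by (apply Rmult_le_pos; lra).
    split.
    + replace (linear_speed eps alpha0 g w + d s - (linear_speed eps alpha0 g w + d s0))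
        with (d s - d s0) by ring. lra.
    + intros k x Hkk. apply Rle_lt_trans with (Rabs (s - s0) * K); [|lra].
      apply HD; auto.
      destruct (Hb s (Hhalf s Hs)) as (B0 & _ & B1 & _).
      destruct (Hb s0 (Hhalf s0 Hs0)) as (B0' & _).
      intros j. apply coefficients_diff_le; auto.
  (* At [s = 0] each mode [j >= 1] carries the factor [0 ^ j], and mode 0 is absent. *)
  - intros x. unfold cos_series. rewrite (Series_ext _ (fun _ => 0 * 0)).
    { rewrite Series_scal_l. ring. }
    intros [|j].
    + rewrite a0 by lra. ring.
    + unfold a, coefficients. rewrite pow_i by lia. unfold Rdiv. ring.
  (* A constant is orthogonal to [cos (N x)] on [[0, PI]], which would force [eta * s = 0]. *)
  - intros s Hs Hs0. apply NNPP. intros Hc.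
    assert (E : forall x, cos_series N 0 (a s) x = cos_series N 0 (a s) 0).
    { intros x. apply NNPP. intros Hx. apply Hc. now exists x, 0. }
    assert (V : is_RInt (fun x => cos_series N 0 (a s) x * cos (INR N * x)) 0 PI
                  (cos_series N 0 (a s) 0 * 0)).
    { apply is_RInt_ext with (fun x => scal (cos_series N 0 (a s) 0) (cos (INR N * x))).
      - intros x _. now rewrite (E x).
      - apply (is_RInt_scal (V := R_NormedModule)).
        generalize (is_RInt_cos N). now rewrite (proj2 (Nat.eqb_neq N 0) HN). }
    assert (X := is_RInt_unique _ _ _ _ V). rewrite (is_RInt_unique _ _ _ _ (Fc s Hs)) in X.
    rewrite Rmult_0_r in X.
    apply Rmult_integral in X. destruct X as [X|X]; [|lra].
    apply Rmult_integral in X. destruct X as [X|X]; [lra | contradiction].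
  - intros s s' Hs Hs' E.
    assert (X := is_RInt_unique _ _ _ _ (Fc s Hs)).
    rewrite (functional_extensionality _ _ E), (is_RInt_unique _ _ _ _ (Fc s' Hs')) in X.
    apply Rmult_eq_reg_r in X; [|lra]. apply Rmult_eq_reg_l in X; lra.
  - intros s Hs. split; [now apply m_fold_cos_series|]. intros T _.
    apply classical_solution_cos_series; auto.
    intros j Hj. destruct (Hb s (Hhalf s Hs)) as (B0 & _ & B1 & B2).
    apply (coefficients_balance N eps alpha0 g (d s) eta s (b s) j); auto; try lia.
    apply B2. lia.
Qed.
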